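(* If $$\mathbf E\big(|\xi|^{\beta}\log^{d-1}|\xi|\big)<\infty$$ for some $\beta\in[1,2)$, then, for each $\varepsilon>0$, almost surely for all sufficiently large $t$, $$\mathcal H(\varepsilon t^{-1+1/\beta})\subset t^{-1/d}\mathcal M_t\subset\mathcal H(-\varepsilon t^{-1+1/\beta}).$$
   Context: Throughout, $d\ge2$ is an integer, $\mathbb N=\{1,2,\dots\}$, $\mathbb R_+^d=[0,\infty)^d$. Components of a vector $x$ are $x^1,\dots,x^d$; for a vector $x\in\mathbb R_+^d$ write $|x|=x^1\cdots x^d$ (product of components), while for a real number $|\cdot|$ is the absolute value. $m\le n$ for vectors is the componentwise order. Convention: $\log c$ is the usual natural logarithm for $c\ge e$ and is set equal to $1$ on $[0,e)$; $\log^{d-1}c=(\log c)^{d-1}$. $\{\xi_m,\ m\in\mathbb N^d\}$ are independent copies of an integrable random variable $\xi$ with finite mean $\mu=\mathbf E\xi>0$. $S_n=\sum_{m\le n}\xi_m$ for $n\in\mathbb N^d$, and $S_n=0$ if $n$ has non-negative integer components at least one of which is zero. $S$ is extended to $\mathbb R_+^d$ by piecewise multilinear interpolation: $S_x=\sum_{k\in C_x}v_k(x)S_{k^*}$, where $C_x$ is the set of vertices of a unit cube (with integer vertices, in $\mathbb R_+^d$) containing $x$, $v_k(x)=\prod_{i=1}^d|x^i-k^i|$ is the volume of the axis-parallel box with diagonally opposite vertices $k$ and $x$, and $k^*$ is the vertex of the cube opposite to $k$ (the value does not depend on the choice of the cube). Renewal sets: $\mathcal M_t=\{x\in\mathbb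 R_+^d: S_x\ge t\}$, $t>0$. For $c\in\mathbb R$, $\mathcal H(c)=\{x\in\mathbb R_+^d:|x|\ge\mu^{-1}+c\}$. ''Almost surely for all sufficiently large $t$'' means: with probability one there is a (possibly random) $t_0$ such that the assertion holds for all $t\ge t_0$. *)

(* Defs.v *)
From HB Require Import structures.
From mathcomp Require Import all_boot all_order all_algebra finmap.
From mathcomp Require Import all_classical all_reals all_analysis.
Set Implicit Arguments.
Unset Strict Implicit.
Unset Printing Implicit Defensive.
Import Order.TTheory GRing.Theory Num.Theory.
Import numFieldNormedType.Exports.
Local Open Scope classical_set_scope.
Local Open Scope ring_scope.

(* Natural logarithm for [expR 1 <= c], and [1] below. *)
Definition logc (R : realType) (c : R) : R :=
  if c < expR 1 then 1 else ln c.

(* Multi-indices have nat entries, 0 included; N = {1, 2, ...}. *)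
Definition posidx (d : nat) : set {ffun 'I_d -> nat} :=
  [set m | forall i, (0 < m i)%N].

Definition orthant (R : realType) (d : nat) : set 'rV[R]_d :=
  [set x | forall i, 0 <= x 0 i].

Definition volume (R : realType) (d : nat) (x : 'rV[R]_d) : R :=
  \prod_i x 0 i.

Section Families.
Context (disp : measure_display) (T : measurableType disp) (R : realType).
Variable P : probability T R.

Definition mutually_independent (I : choiceType) (D : set I)
    (xi : I -> {RV P >-> R}) : Prop :=
  forall (J : {fset I}) (A : I -> set R),
    [set` J] `<=` D -> (forall m, m \in J -> measurable (A m)) ->
    P (\bigcap_(m in [set` J]) (xi m @^-1` A m)) =
    (\prod_(m <- J) P (xi m @^-1` A m))%E.

Definition same_distribution (X Y : {RV P >-> R}) : Prop :=
  forall A : set R, measurable A -> distribution P X A = distribution P Y A.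

(* [X] needs no relation to the family beyond its law. *)
Definition independent_copies (I : choiceType) (D : set I)
    (xi : I -> {RV P >-> R}) (X : {RV P >-> R}) : Prop :=
  mutually_independent D xi /\ forall m, D m -> same_distribution (xi m) X.

End Families.

Section Sums.
Variables (R : realType) (d : nat).
Implicit Types (s a : {ffun 'I_d -> nat} -> R) (n : {ffun 'I_d -> nat}).

(* The index set is empty as soon as some [n i] is 0, so the sum is then 0. *)
Definition lattice_sum a n : R :=
  \sum_(m \in [set m | posidx m /\ forall i, (m i <= n i)%N]) a m.

Definition cube_vertex n (e : {ffun 'I_d -> bool}) : {ffun 'I_d -> nat} :=
  [ffun i => (n i + e i)%N].

Definition opposite (e : {ffun 'I_d -> bool}) : {ffun 'I_d -> bool} :=
  [ffun i => ~~ e i].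

(* Interpolation of [s] on the unit cube with lowest vertex [n]: the value at
   a vertex is weighted by the volume of the box spanned by [x] and the
   opposite vertex. *)
Definition cube_interp s n (x : 'rV[R]_d) : R :=
  \sum_(e : {ffun 'I_d -> bool})
    (\prod_i `|x 0 i - (cube_vertex n e i)%:R|)
      * s (cube_vertex n (opposite e)).

(* All unit cubes containing a point [x] of the orthant give the same value;
   the one whose lowest vertex is the componentwise integer part is used. *)
Definition multilinear_ext s (x : 'rV[R]_d) : R :=
  cube_interp s [ffun i => Num.truncn (x 0 i)] x.

End Sums.

Definition renewal_set (R : realType) (d : nat)
    (a : {ffun 'I_d -> nat} -> R) (t : R) : set 'rV[R]_d :=
  [set x | orthant x /\ t <= multilinear_ext (lattice_sum a) x].

Definition Hset (R : realType) (d : nat) (mu c : R) : set 'rV[R]_d :=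
  [set x | orthant x /\ mu^-1 + c <= volume x].

Definition scale_set (R : realType) (d : nat) (c : R) (A : set 'rV[R]_d) :
  set 'rV[R]_d := [set c *: x | x in A].

(* Main.v *)
(* Since the product of coordinates is itself multilinear, S - mu|.| is the
   interpolation of its values at lattice points.  It therefore suffices to
   show that, for each eta > 0, almost surely |S_n - mu|n|| <= eta|n|^(1/beta)
   + C for all n, with C random: the concavity of u |-> u^(1/beta) carries this
   bound over to all points of the orthant, and both inclusions then follow by
   comparing mu|x| +- eta|x|^(1/beta) with t.

   The lattice bound is a strong law of Marcinkiewicz-Zygmund type.  Split N^d
   into dyadic blocks of volume 2^j and, in each such block, truncate all the
   variables at 2^(j/beta).  Iterating Etemadi's maximal inequality over the d
   coordinates and using Chebyshev's inequality, a block is bad with probability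
   at most a constant times
     2^j P(|xi| > 2^(j/beta)) + 2^(j - 2j/beta) E(xi^2; |xi| <= 2^(j/beta)).
   There are at most (j+1)^(d-1) blocks of volume 2^j, and the sum over j of
   (j+1)^(d-1) times this quantity is at most a constant times
   E(|xi|^beta log^(d-1)|xi|), so the Borel-Cantelli lemma applies. *)
Require Import Defs.
From HB Require Import structures.
From mathcomp Require Import all_boot all_order all_algebra finmap.
From mathcomp Require Import all_classical all_reals all_analysis.
From mathcomp Require Import measurable_realfun ring lra.
Import Order.TTheory GRing.Theory Num.Theory.
Import numFieldNormedType.Exports.
Local Open Scope classical_set_scope.
Local Open Scope ring_scope.
Set Implicit Arguments.
Unset Strict Implicit.
Unset Printing Implicit Defensive.

(** * Independence of events from disjoint groups of variables *)

Section Independence.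
Context (disp : measure_display) (T : measurableType disp) (R : realType).
Variable P : probability T R.

(** Dynkin's pi-lambda argument, used twice: [half] passes from [G2] to [<<s G2 >>] against a fixed
    event of [G1], then from [G1] to [<<s G1 >>] against a fixed event of [<<s G2 >>]. *)
Lemma g_sigma_indep (G1 G2 : set (set T)) :
  setI_closed G1 -> setI_closed G2 ->
  G1 `<=` measurable -> G2 `<=` measurable ->
  (forall A B, G1 A -> G2 B -> P (A `&` B) = (P A * P B)%E) ->
  forall A B, <<s G1 >> A -> <<s G2 >> B -> P (A `&` B) = (P A * P B)%E.
Proof.
have half (G : set (set T)) (C : set T) : setI_closed G -> G `<=` measurable ->
    measurable C -> (forall A, G A -> P (A `&` C) = (P A * P C)%E) ->
    forall A, <<s G >> A -> P (A `&` C) = (P A * P C)%E.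
  move=> GI Gm mC GC A sGA.
  suff: [set A | measurable A /\ P (A `&` C) = (P A * P C)%E] A by case.
  apply: (lambda_system_subset GI) sGA => // [|B GB]; last first.
    by split; [exact: Gm|exact: GC].
  apply/dynkin_lambda_system; split => /=.
  - by split=> //; rewrite setTI probability_setT mul1e.
  - move=> B [mB PB]; split; first exact: measurableC.
    have -> : ~` B `&` C = C `\` (B `&` C).
      by rewrite setIC -setDE; apply/seteqP; split => x /= [Cx nB]; split=> //; tauto.
    rewrite measureD ?(le_lt_trans (probability_le1 _ _) (ltry _))//=; last exact: measurableI.
    rewrite setIC -setIA setIid PB probability_setC// muleBl ?mul1e// ?fin_num_measure//.
  - move=> F tF FP.
    have mF n : measurable (F n) by have [] := FP n.
    split; first exact: bigcup_measurable.
    rewrite setI_bigcupl measure_semi_bigcup//; last 3 first.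
    - by move=> n; exact: measurableI.
    - by apply: trivIset_setIr.
    - by apply: bigcup_measurable => n _; exact: measurableI.
    rewrite measure_semi_bigcup//; last exact: bigcup_measurable.
    rewrite muleC -(fineK (fin_num_measure P _ mC)) -nneseriesZl//.
    by apply: eq_eseriesr => n _; rewrite fineK ?fin_num_measure// muleC; have [] := FP n.
move=> I1 I2 m1 m2 G12 A B sA sB.
apply: (half G1) => //.
  by apply: sB; split => //; exact: sigma_algebra_measurable.
move=> C GC; rewrite setIC muleC; apply: (half G2) => //; first exact: m1.
by move=> E GE; rewrite setIC muleC; exact: G12.
Qed.


Context (I : choiceType).
Implicit Types (J : {fset I}) (p : pred I) (Z : I -> T -> R).

(** Stated for bare functions rather than [{RV P >-> R}], so that truncated and centered variables
    need not be packed. *)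
Definition mut_indep (D : set I) Z :=
  forall J (A : I -> set R),
    [set` J] `<=` D -> (forall m, m \in J -> measurable (A m)) ->
    P (\bigcap_(m in [set` J]) (Z m @^-1` A m)) =
    (\prod_(m <- J) P (Z m @^-1` A m))%E.

(** Indices of [J] outside [p] carry [setT] instead of being dropped: events for [p] and for
    [predC p] are then intersections over the same [J]. *)
Definition cylinder Z J p : set (set T) :=
  [set A | exists2 B : I -> set R, forall m, measurable (B m) &
    A = \bigcap_(m in [set` J]) Z m @^-1` (if p m then B m else setT)].

Lemma cylinder_setI Z J p : setI_closed (cylinder Z J p).
Proof.
move=> _ _ [B mB ->] [C mC ->]; exists (fun m => B m `&` C m).
  by move=> m; exact: measurableI.
rewrite -bigcapI; apply: eq_bigcapr => m _.
by case: (p m); rewrite ?preimage_setI// setIid.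
Qed.

Lemma cylinder_measurable Z J p : (forall m, measurable_fun setT (Z m)) ->
  cylinder Z J p `<=` measurable.
Proof.
move=> mZ _ [B mB ->]; apply: fin_bigcap_measurable; first exact: finite_fset.
move=> m _; rewrite -[X in measurable X]setTI; apply: mZ => //.
by case: (p m).
Qed.

Lemma cylinder_measurable_fun Z J p m : m \in J -> p m ->
  measurable_fun setT (Z m : g_sigma_algebraType (cylinder Z J p) -> R).
Proof.
move=> mJ pm _ B mB; rewrite setTI; apply: sub_sigma_algebra.
exists (fun i => if i == m then B else setT); first by move=> i; case: eqP.
apply/seteqP; split=> [w Bw i _|w /(_ m)]/=.
  by case: (p i) => //; case: eqP => // ->.
by rewrite pm eqxx; apply.
Qed.

(** On cylinders the formula factors index by index, since at each index one of the two sets is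
    [setT]; [g_sigma_indep] passes to the generated sigma-algebras. *)
Lemma mut_indep_split D Z J p A B : (forall m, measurable_fun setT (Z m)) ->
  mut_indep D Z -> [set` J] `<=` D ->
  <<s cylinder Z J p >> A -> <<s cylinder Z J (predC p) >> B ->
  P (A `&` B) = (P A * P B)%E.
Proof.
move=> mZ iZ JD; apply: g_sigma_indep; [exact: cylinder_setI..| | |].
- exact: cylinder_measurable.
- exact: cylinder_measurable.
move=> _ _ [C mC ->] [E mE ->].
rewrite -bigcapI.
under eq_bigcapr do rewrite -preimage_setI.
rewrite !iZ//; try by move=> m _ /=; case: (p m); rewrite /= ?setIT ?setTI.
rewrite -big_split/=; apply: eq_bigr => m _.
by case: (p m); rewrite /= ?setIT ?setTI preimage_setT probability_setT ?mule1 ?mul1e.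
Qed.

End Independence.

(** * Maximal inequalities *)

(** Measurability is asked only of the summands that occur, so that [T] may carry the smaller
    sigma-algebra generated by the cylinders of a group of variables. *)
Lemma measurable_big d (T : measurableType d) (R : realType) (I : choiceType)
    (Z : I -> T -> R) (J : {fset I}) (q : pred I) :
  (forall m, m \in J -> q m -> measurable_fun setT (Z m)) ->
  measurable_fun setT (fun w => \sum_(m <- J | q m) Z m w).
Proof.
move=> mZ; rewrite (_ : (fun w => _) =
    fun w => \sum_(m <- J) if (m \in J) && q m then Z m w else 0); last first.
  by apply/funext => w; rewrite big_seq_cond big_mkcond.
apply: (@measurable_sum _ _ _ _ _ _ (fun m w => if (m \in J) && q m then Z m w else 0)) => m.
by case: (boolP ((m \in J) && q m)) => [/andP[mJ qm]|_]; [exact: mZ|exact: measurable_cst].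
Qed.

Lemma measurable_exceed d (T : measurableType d) (R : realType) (F : countType)
    (L : set F) (h : F -> T -> R) (y : R) :
  (forall f, measurable_fun setT (h f)) ->
  measurable (\bigcup_(f in L) [set w | y <= `|h f w|]).
Proof.
move=> mh; rewrite bigcup_mkcond; apply: countable_bigcupT_measurable => // f.
case: ifP => // _.
rewrite (_ : [set w | _] = setT `&` (fun w => `|h f w|) @^-1` `[y, +oo[).
  by apply: measurableT_comp => //; exact: mh.
by apply/seteqP; split => w /=; rewrite in_itv/= andbT; tauto.
Qed.

Section Etemadi.
Context (disp : measure_display) (T : measurableType disp) (R : realType).
Variable P : probability T R.
Context (I : choiceType) (D : set I) (Z : I -> T -> R).
Hypothesis mZ : forall m, measurable_fun setT (Z m).
Hypothesis iZ : mut_indep P D Z.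
Context (J : {fset I}) (lev : I -> nat).
Hypothesis JD : [set` J] `<=` D.
Context (F : countType) (L : set F) (B : F -> pred I).

Definition layer_sum f k w := \sum_(m <- J | B f m && (lev m <= k)%N) Z m w.

Definition exceed k (y : R) : set T :=
  \bigcup_(f in L) [set w | y <= `|layer_sum f k w|].

Lemma exceed_measurable k y : measurable (exceed k y).
Proof.
by apply: measurable_exceed => f; apply: measurable_big => m _ _; exact: mZ.
Qed.

(* Etemadi's inequality, for sums taking values in a sup-normed space: the
   layers [lev m = k] play the role of the independent summands. *)
Lemma etemadi n (x c : R) :
  (forall k, (k <= n)%N -> (P (exceed k x) <= c%:E)%E) ->
  (P (\bigcup_(k < n.+1) exceed k (3 * x)) <= (3 * c)%:E)%E.
Proof.
(* [A k] is first passage: the sup norm reaches [3 * x] at time [k] and not before. [V k] below is a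
   large increment between times [k] and [n]. *)
move=> Pc; pose U k := exceed k (3 * x); pose A := seqDU U.
have mU k : measurable (U k) by exact: exceed_measurable.
have mA k : measurable (A k) by exact: seqDU_measurable.
pose V k := \bigcup_(f in L) [set w | 2 * x <= `|layer_sum f n w - layer_sum f k w|].
have mV k : measurable (V k).
  apply: measurable_exceed => f; apply: measurable_funB.
    by apply: measurable_big => m _ _; exact: mZ.
  by apply: measurable_big => m _ _; exact: mZ.
have c0 : 0 <= c by rewrite -lee_fin (le_trans _ (Pc 0%N _)).
have PV k : (k <= n)%N -> (P (V k) <= (2 * c)%:E)%E.
  move=> kn; apply: (@le_trans _ _ (P (exceed n x `|` exceed k x))).
    apply: le_measure; rewrite ?inE//.
      by apply: measurableU; exact: exceed_measurable.
    move=> w [f Lf /= xw].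
    have [xn|nx] := leP x `|layer_sum f n w|; first by left; exists f.
    have [xk|kx] := leP x `|layer_sum f k w|; first by right; exists f.
    have := ler_normB (layer_sum f n w) (layer_sum f k w).
    by move: xw nx kx; lra.
  apply: (le_trans (measureU2 _ (exceed_measurable n x) (exceed_measurable k x))).
  by rewrite [2 * c]mulr_natl mulr2n EFinD leeD// Pc.
(* [A k] depends on the layers up to [k] only, the increment in [V k] on the later ones. *)
have AV k : (k <= n)%N -> P (A k `&` V k) = (P (A k) * P (V k))%E.
  move=> kn; apply: (mut_indep_split (p := fun m => (lev m <= k)%N) mZ iZ JD).
    have mUi i : (i <= k)%N ->
        <<s cylinder Z J (fun m => (lev m <= k)%N) >> (U i).
      move=> ik; apply: (@measurable_exceed _
        (g_sigma_algebraType (cylinder Z J (fun m => (lev m <= k)%N)))) => f.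
      apply: measurable_big => m mJ /andP[_ mi].
      by apply: cylinder_measurable_fun => //; exact: leq_trans mi ik.
    apply: (@measurableD _
        (g_sigma_algebraType (cylinder Z J (fun m => (lev m <= k)%N)))).
      exact: mUi.
    by apply: bigsetU_measurable => i _; apply: mUi; exact: ltnW.
  apply: (@measurable_exceed _
    (g_sigma_algebraType (cylinder Z J (predC (fun m => (lev m <= k)%N))))) => f.
  rewrite (_ : (fun w => _) = fun w =>
      \sum_(m <- J | [&& B f m, (lev m <= n)%N & ~~ (lev m <= k)%N]) Z m w).
    apply: measurable_big => m mJ /and3P[_ _ mk].
    exact: cylinder_measurable_fun.
  apply/funext => w; rewrite /layer_sum.
  rewrite (bigID (fun m => lev m <= k)%N)/= addrC.
  rewrite [X in _ + X - _](eq_bigl (fun m => B f m && (lev m <= k)%N)).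
    by rewrite addrK; apply: eq_bigl => m; rewrite andbA.
  by move=> m; case: (leqP (lev m) k) => [mk|]; rewrite ?andbF// (leq_trans mk kn) !andbT.
have PUA : P (\bigcup_(k < n.+1) U k) = (\sum_(k < n.+1) P (A k))%E.
  by rewrite bigcup_mkord bigsetU_seqDU measure_bigsetU//; exact: trivIset_seqDU.
rewrite PUA.
(* On [A k] some component reaches [3 * x], so its final value is at least [x] or its remaining
   increment at least [2 * x] in absolute value. The former events are disjoint parts of
   [exceed n x] and cost [c]; the latter cost [2 * c] times a total probability at most 1. *)
apply: (@le_trans _ _ (\sum_(k < n.+1) (P (A k `&` exceed n x) + P (A k) * (2 * c)%:E))%E).
  apply: lee_sum => -[k kn] _ /=.
  apply: (@le_trans _ _ (P (A k `&` exceed n x) + P (A k `&` V k))%E); last first.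
    by rewrite leeD2l// AV// lee_wpmul2l// PV.
  apply: le_trans (measureU2 _ _ _); [|apply: measurableI => //; exact: exceed_measurable|exact: measurableI].
  apply: le_measure; rewrite ?inE//.
    by apply: measurableU; apply: measurableI => //; exact: exceed_measurable.
  move=> w Aw; rewrite -setIUr; split=> //.
  have [f Lf /= xw] := subset_seqDU Aw.
  have [xn|nx] := leP x `|layer_sum f n w|; first by left; exists f.
  right; exists f => //=.
  have := lerB_normD (layer_sum f k w) (- layer_sum f n w).
  by rewrite normrN distrC; move: xw nx; lra.
rewrite big_split/= -ge0_sume_distrl//.
rewrite (_ : 3 * c = c + 2 * c); last by ring.
rewrite EFinD leeD//.
  have <- : P (\bigcup_(k < n.+1) (A k `&` exceed n x)) =
      (\sum_(k < n.+1) P (A k `&` exceed n x))%E.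
    rewrite bigcup_mkord (@measure_bigsetU _ _ _ P (fun k => A k `&` exceed n x))//.
      by move=> k; apply: measurableI => //; exact: exceed_measurable.
    by apply: trivIset_setIr; exact: trivIset_seqDU.
  apply: le_trans (Pc n (leqnn n)); apply: le_measure; rewrite ?inE.
  - by apply: bigcup_measurable => k _; apply: measurableI => //; exact: exceed_measurable.
  - exact: exceed_measurable.
  - by move=> w [k _ []].
rewrite -PUA -[leRHS]mul1e lee_wpmul2r ?lee_fin ?mulr_ge0//.
by apply: probability_le1; apply: bigcup_measurable.
Qed.

End Etemadi.

(** * Finite boxes of multi-indices *)

Section Box.
Context (R : realType) (d : nat).
Local Notation I := {ffun 'I_d -> nat}.
Implicit Types (n m N : I) (a : I -> R).

Definition ord_box n : set I := [set m | posidx m /\ forall i, (m i <= n i)%N].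

Lemma finite_ord_box n : finite_set (ord_box n).
Proof.
pose M := (\sum_i n i)%N.
apply: (@sub_finite_set _ _ ((fun g : {ffun 'I_d -> 'I_M.+1} =>
    [ffun i => nat_of_ord (g i)]) @` setT)); last first.
  by apply: finite_image; exact: finite_finset.
move=> m [_ mn]; exists [ffun i => inord (m i)] => //.
apply/ffunP => i; rewrite !ffunE inordK// ltnS (leq_trans (mn i))//.
by rewrite /M (bigD1 i)//= leq_addr.
Qed.

(** Sums over all sub-boxes of [N] run over one finite set and differ only by a predicate, which is
    the form of [layer_sum]. *)
Lemma lattice_sum_box a n N : (forall i, (n i <= N i)%N) ->
  lattice_sum a n =
  \sum_(m <- fset_set (ord_box N) | [forall i, (m i <= n i)%N]) a m.
Proof.
move=> nN; rewrite /lattice_sum fsbig_finite; last exact: finite_ord_box.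
rewrite -[RHS]big_filter; apply: perm_big; apply: uniq_perm.
- exact: fset_uniq.
- by apply: filter_uniq; exact: fset_uniq.
move=> m; rewrite mem_filter !in_fset_set; [|exact: finite_ord_box..].
apply/idP/idP.
  rewrite inE /= => -[m0 mn]; apply/andP; split; first exact/forallP.
  by rewrite inE; split => // i; exact: leq_trans (mn i) (nN i).
by move=> /andP[/forallP mn]; rewrite inE => -[m0 _]; rewrite inE.
Qed.

End Box.

(** * Maximal inequality over a box of the lattice *)

Section MaximalInequality.
Context (disp : measure_display) (T : measurableType disp) (R : realType).
Variable P : probability T R.
Context (d : nat).
Local Notation I := {ffun 'I_d -> nat}.
Variable Z : I -> T -> R.
Hypothesis mZ : forall m, measurable_fun setT (Z m).

Local Notation S n w := (lattice_sum (Z ^~ w) n).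

Lemma measurable_lattice_sum n : measurable_fun setT (fun w => S n w).
Proof.
under eq_fun do rewrite (lattice_sum_box _ (fun i => leqnn (n i))).
by apply: measurable_big => m _ _; exact: mZ.
Qed.

(* [C j n] below frees the first [j] coordinates; Etemadi's inequality along
   coordinate [j], applied to sums indexed by [C j n], frees one more. *)
Lemma lattice_maximal_ineq (N : I) (x c : R) : mut_indep P (@posidx d) Z ->
  (forall n : I, (forall i, (n i <= N i)%N) -> (P [set w | (x <= `|S n w|)%R] <= c%:E)%E) ->
  (P (\bigcup_(n in [set n : I | forall i, (n i <= N i)%N])
        [set w | (3 ^+ d * x <= `|S n w|)%R]) <= (3 ^+ d * c)%:E)%E.
Proof.
move=> iZ Pc.
pose C j (n : I) : set I :=
  [set m : I | forall i : 'I_d, if (i < j)%N then (m i <= n i)%N else m i == n i].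
pose U (L : set I) (y : R) := \bigcup_(m in L) [set w | (y <= `|S m w|)%R].
have mU L y : measurable (U L y).
  by apply: measurable_exceed => n; exact: measurable_lattice_sum.
suff claim (j : nat) : (j <= d)%N -> forall n : I, (forall i, (n i <= N i)%N) ->
    (P (U (C j n) (3 ^+ j * x)%R) <= (3 ^+ j * c)%:E)%E.
  apply: le_trans (claim d (leqnn d) N (fun i => leqnn (N i))).
  apply: le_measure; rewrite ?inE//; [exact: mU..|].
  move=> w [n /= nN xw]; exists n => // i.
  by rewrite ltn_ord.
elim: j => [_ n nN|j IHj jd n nN].
  rewrite !expr0 !mul1r; apply: le_trans (Pc n nN).
  apply: le_measure; first exact/mem_set/mU.
    by apply: mem_set; have := mU [set n] x; rewrite /U bigcup_set1.
  by move=> w [m /= Cm xw]; rewrite (_ : n = m)//; apply/ffunP => i; have /eqP := Cm i.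
(* Coordinate [i0] plays the role of time in Etemadi's inequality. [B f] constrains the other
   coordinates by [f], so that the layers up to [k] add up to the sum over the box [upd f k]. *)
pose i0 := Ordinal jd.
pose upd (f : I) k : I := [ffun i => if i == i0 then k else f i].
pose B (f : I) : pred I := fun m => [forall i, (i != i0) ==> (m i <= f i)%N].
have JD : [set` fset_set (ord_box N)] `<=` @posidx d.
  move=> m; rewrite fset_setK; last exact: finite_ord_box.
  by case.
have layerE f k w : (forall i, (upd f k i <= N i)%N) ->
    layer_sum Z (fset_set (ord_box N)) (fun m => m i0) B f k w = S (upd f k) w.
  move=> fN; rewrite (lattice_sum_box _ fN) /layer_sum.
  apply: eq_bigl => m; apply/andP/forallP => [[/forallP mf mk] i|mfk].
    by rewrite ffunE; case: eqP => [->//|/eqP ii0]; have := mf i; rewrite ii0.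
  split; last by have := mfk i0; rewrite ffunE eqxx.
  apply/forallP => i; apply/implyP => ii0; have := mfk i.
  by rewrite ffunE (negbTE ii0).
have updC f k : C j n f -> (k <= n i0)%N -> C j (upd n k) (upd f k).
  move=> Cf kn i; rewrite !ffunE; have := Cf i.
  by case: (i =P i0) => [->|//]; rewrite /= ltnn.
have CN f k : C j n f -> (k <= n i0)%N -> forall i, (upd f k i <= N i)%N.
  move=> Cf kn i; rewrite ffunE; have := Cf i.
  case: (i =P i0) => [->|_]; first by rewrite (leq_trans kn).
  by case: ifP => [_ fn|_ /eqP->//]; exact: leq_trans fn (nN i).
have := @etemadi _ _ _ P _ _ _ mZ iZ _ (fun m : I => m i0) JD _ (C j n) B
  (n i0) (3 ^+ j * x) (3 ^+ j * c).
rewrite exprS -!mulrA => et; apply: le_trans (et _); last first.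
  move=> k kn; apply: le_trans (IHj (ltnW jd) (upd n k) _); last first.
    move=> i; rewrite ffunE; case: eqP => [->|_ //]; exact: leq_trans kn (nN i0).
  apply: le_measure; [exact/mem_set/exceed_measurable|exact/mem_set/mU|].
  move=> w [f Cf /= xw]; exists (upd f k); first exact: updC.
  by rewrite /= -layerE//; exact: CN.
apply: le_measure; first exact/mem_set/mU.
  by apply: mem_set; apply: bigcup_measurable => k _; exact: exceed_measurable.
move=> w [m /= Cm xw]; exists (m i0) => /=.
  by rewrite ltnS; have := Cm i0; rewrite ltnSn.
(* The component is labelled by [m] with entry [i0] reset to [n i0], as members of [C j n] must
   agree with [n] there; the original entry [m i0] is the time. *)
have Cf : C j n (upd m (n i0)).
  move=> i; rewrite ffunE; case: (i =P i0) => [->|/eqP ii0]; first by rewrite /= ltnn.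
  have := Cm i; rewrite ltnS leq_eqVlt.
  suff -> : (nat_of_ord i == j) = false by [].
  by apply: contraNF ii0 => /eqP ij; apply/eqP/val_inj.
exists (upd m (n i0)) => //=; rewrite layerE.
  rewrite (_ : upd _ _ = m)//; apply/ffunP => i; rewrite !ffunE.
  by case: eqP => [->|].
by apply: CN => //; have := Cm i0; rewrite ltnSn.
Qed.

End MaximalInequality.

(** * Second moments of sums *)

Section SecondMoment.
Context (disp : measure_display) (T : measurableType disp) (R : realType).
Variable P : probability T R.

Lemma bounded_integrable (f : T -> R) (K : R) :
  measurable_fun setT f -> (forall w, `|f w| <= K) ->
  P.-integrable setT (EFin \o f).
Proof.
move=> mf fK; apply: measurable_bounded_integrable => //.
  by rewrite (le_lt_trans (probability_le1 _ _)) ?ltry.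
exists K; split; first exact: num_real.
by move=> M KM w _ /=; rewrite (le_trans (fK w))// ltW.
Qed.

(** The law of the pair agrees with the product of the laws on rectangles, hence everywhere;
    Fubini's theorem then factors the integral. Boundedness supplies integrability. *)
Lemma indep_expectationM (X Y : {RV P >-> R}) (K : R) :
  (forall A B, measurable A -> measurable B ->
    P (X @^-1` A `&` Y @^-1` B) = (P (X @^-1` A) * P (Y @^-1` B))%E) ->
  (forall w, `|X w| <= K) -> (forall w, `|Y w| <= K) ->
  (\int[P]_w (X w * Y w)%:E = \int[P]_w (X w)%:E * \int[P]_w (Y w)%:E)%E.
Proof.
move=> XY XK YK.
have mXY : measurable_fun setT (fun w => (X w, Y w)).
  by apply: measurable_fun_pair => //; exact: measurable_funPT.
pose W : {RV P >-> (R * R)%type} := HB.pack (fun w => (X w, Y w))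
  (isMeasurableFun.Build _ _ _ _ (fun w => (X w, Y w)) mXY).
pose f (z : R * R) : \bar R := (z.1 * z.2)%:E.
have mf : measurable_fun setT f by apply/measurable_EFinP; exact: measurable_funM.
have iX : P.-integrable setT (EFin \o X) by apply: (bounded_integrable _ XK).
have iY : P.-integrable setT (EFin \o Y) by apply: (bounded_integrable _ YK).
have iW : P.-integrable setT (f \o W).
  apply: (@bounded_integrable (fun w => X w * Y w) (K * K)).
    by apply: measurable_funM.
  by move=> w; rewrite normrM ler_pM.
have WE A : measurable A -> (distribution P X \x distribution P Y)%E A = distribution P W A.
  by apply: product_measure_unique => B C mB mC; rewrite -XY.
have iWd : (distribution P W).-integrable setT f.
  by apply: integrable_pushforward.
have iXY : (distribution P X \x distribution P Y)%E.-integrable setT f.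
  apply/integrableP; split => //.
  have /integrableP[_] := iWd.
  by rewrite (eq_measure_integral (distribution P X \x distribution P Y)%E)// => A mA _; exact/esym/WE.
have idX : (distribution P X).-integrable setT EFin.
  by apply: integrable_pushforward.
have idY : (distribution P Y).-integrable setT EFin.
  by apply: integrable_pushforward.
transitivity (\int[distribution P W]_z f z)%E.
  by rewrite integral_distribution.
rewrite (eq_measure_integral (distribution P X \x distribution P Y)%E); last first.
  by move=> A mA _; exact/esym/WE.
rewrite -integral12_prod_meas1//.
have EY : (\int[P]_w (Y w)%:E)%E = (\int[distribution P Y]_y y%:E)%E.
  by rewrite integral_distribution.
have EX : (\int[P]_w (X w)%:E)%E = (\int[distribution P X]_y y%:E)%E.
  by rewrite integral_distribution.
have Yfin : (\int[P]_w (Y w)%:E)%E \is a fin_num by exact: integrable_fin_num.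
rewrite EX -(fineK Yfin) muleC -integralZl//.
apply: eq_integral => x _; rewrite /fubini_F fineK// EY muleC -integralZl//.
Qed.

(** Independence and centering remove the off-diagonal terms of the expanded square. The number of
    summands is kept as a sum of ones, which [lattice_sum_cst] later turns into a box volume. *)
Lemma second_moment_le (I : choiceType) (D : set I) (Z : I -> T -> R)
    (J : {fset I}) (p : pred I) (K v : R) :
  (forall m, measurable_fun setT (Z m)) -> mut_indep P D Z ->
  [set` J] `<=` D -> (forall m w, `|Z m w| <= K) ->
  (forall m, D m -> (\int[P]_w (Z m w)%:E = 0)%E) ->
  (forall m, D m -> (\int[P]_w (Z m w ^+ 2)%:E <= v%:E)%E) ->
  (\int[P]_w ((\sum_(m <- J | p m) Z m w) ^+ 2)%:E <= ((\sum_(m <- J | p m) 1) * v)%:E)%E.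
Proof.
move=> mZ iZ JD ZK Z0 Zv.
have iZZ m m' : P.-integrable setT (fun w => (Z m w * Z m' w)%:E).
  apply: (@bounded_integrable (fun w => Z m w * Z m' w) (K * K)).
    by apply: measurable_funM.
  by move=> w; rewrite normrM ler_pM.
have cross m m' : D m -> D m' -> m != m' -> (\int[P]_w (Z m w * Z m' w)%:E = 0)%E.
  move=> Dm Dm' mm'.
  pose X : {RV P >-> R} := HB.pack (Z m) (isMeasurableFun.Build _ _ _ _ (Z m) (mZ m)).
  pose Y : {RV P >-> R} := HB.pack (Z m') (isMeasurableFun.Build _ _ _ _ (Z m') (mZ m')).
  rewrite (@indep_expectationM X Y K _ (ZK m) (ZK m'))//; first by rewrite Z0// mul0e.
  move=> A B mA mB.
  pose C i := if i == m then A else B.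
  have := iZ [fset m; m']%fset C; rewrite big_fsetU1 ?inE//= big_seq_fset1 /C eqxx.
  rewrite [m' == m]eq_sym (negbTE mm') => <-.
  - congr (P _); apply/seteqP; split => [w [Aw Bw] i|w /= h].
      by rewrite /= !inE => /orP[]/eqP ->; rewrite ?eqxx// eq_sym (negbTE mm').
    by split; [have := h m|have := h m']; rewrite /= !inE eqxx ?orbT ?[m' == m]eq_sym ?(negbTE mm') ?eqxx; apply.
  - by move=> i; rewrite /= !inE => /orP[]/eqP ->.
  - by move=> i _; case: ifP.
have -> : (\int[P]_w ((\sum_(m <- J | p m) Z m w) ^+ 2)%:E)%E =
    (\sum_(m <- J | p m) \sum_(m' <- J | p m') \int[P]_w (Z m w * Z m' w)%:E)%E.
  under eq_bigr do rewrite -integral_sum//.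
  rewrite -integral_sum//; last by move=> m; apply: integrable_sum => //.
  apply: eq_integral => w _; rewrite expr2 mulr_suml -sumEFin; apply: eq_bigr => m _.
  by rewrite mulr_sumr -sumEFin.
rewrite mulr_suml -sumEFin big_seq_cond [leRHS]big_seq_cond; apply: lee_sum => m /andP[mJ pm].
rewrite big_mkcond (bigD1_seq m) ?fset_uniq//= pm.
rewrite big_seq_cond big1 ?adde0 => [|m' /andP[m'J m'm]].
  by rewrite mul1r; apply: Zv; exact: JD.
case: ifP => // _.
by apply: cross; [exact: JD|exact: JD|rewrite eq_sym].
Qed.

(** Chebyshev's inequality, from Markov's inequality for the square of [f]. *)
Lemma second_moment_tail (f : T -> R) (x v : R) : measurable_fun setT f -> 0 < x ->
  (\int[P]_w ((f w) ^+ 2)%:E <= v%:E)%E ->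
  (P [set w | (x <= `|f w|)%R] <= (v / x ^+ 2)%:E)%E.
Proof.
move=> mf x0 fv; have x20 : 0 < x ^+ 2 by rewrite exprn_gt0.
have mf2 : measurable_fun setT (fun w => (f w ^+ 2)%:E).
  by apply/measurable_EFinP; exact: measurable_funX.
have := le_integral_abse P measurableT mf2 x20.
rewrite setTI (_ : [set w | _] = [set w | (x <= `|f w|)%R]); last first.
  have E w : (x ^+ 2 <= `|f w ^+ 2|) = (x <= `|f w|).
    by rewrite normrX ler_sqr ?nnegrE// ltW.
  by apply/seteqP; split => w /=; rewrite lee_fin E.
under eq_integral do rewrite /= ger0_norm ?sqr_ge0//.
move=> /le_trans/(_ fv) Pv.
by rewrite EFinM lee_pdivlMr// muleC.
Qed.

End SecondMoment.

(** * Box volumes and counting *)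

Section BoxVolume.
Context (R : realType) (d : nat).
Local Notation I := {ffun 'I_d -> nat}.
Implicit Types (n : I) (a : I -> R).

Definition box_volume n : R := \prod_i (n i)%:R.

Lemma box_volume_ge0 n : 0 <= box_volume n.
Proof. by apply: prodr_ge0 => i _; exact: ler0n. Qed.

Lemma le_box_volume n n' : (forall i, (n i <= n' i)%N) -> box_volume n <= box_volume n'.
Proof. by move=> nn'; apply: ler_prod => i _; rewrite ler0n ler_nat nn'. Qed.

(** Indexing by finite functions into ['I_M.+1] prepares the distribution of a product over sums in
    [lattice_sum_cst]. *)
Lemma lattice_sum_ffun a n (M : nat) : (forall i, (n i <= M)%N) ->
  lattice_sum a n =
  \sum_(f : {ffun 'I_d -> 'I_M.+1} | [forall i, (0 < f i <= n i)%N])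
     a [ffun i => f i : nat].
Proof.
move=> nM; rewrite /lattice_sum fsbig_finite; last exact: finite_ord_box.
rewrite -[RHS]big_filter.
rewrite -(big_map (fun f : {ffun 'I_d -> 'I_M.+1} => [ffun i => f i : nat]) predT a).
apply: perm_big; apply: uniq_perm; first exact: fset_uniq.
  rewrite map_inj_uniq; first by rewrite filter_uniq// index_enum_uniq.
  move=> f g /ffunP fg; apply/ffunP => i; apply/val_inj.
  by have := fg i; rewrite !ffunE.
move=> m; rewrite in_fset_set; last exact: finite_ord_box.
apply/idP/mapP.
  rewrite inE => -[m0 mn]; exists [ffun i => inord (m i)].
    rewrite mem_filter mem_index_enum andbT; apply/forallP => i.
    by rewrite ffunE inordK ?m0 ?mn// ltnS (leq_trans (mn i)).
  by apply/ffunP => i; rewrite !ffunE inordK// ltnS (leq_trans (mn i)).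
move=> [f]; rewrite mem_filter mem_index_enum andbT => /forallP f0 ->.
by rewrite inE; split => i; rewrite ffunE; have /andP[] := f0 i.
Qed.

Lemma lattice_sum_cst (c : R) n : lattice_sum (fun=> c) n = c * box_volume n.
Proof.
rewrite (@lattice_sum_ffun _ _ (\sum_i n i)%N); last first.
  by move=> i; rewrite (bigD1 i)//= leq_addr.
set M := (\sum_i n i)%N.
have nM i : (n i <= M)%N by rewrite /M (bigD1 i)//= leq_addr.
(* Each [n i] is a sum of indicators over a common range; expanding the product of these sums counts
   the indices of the box. *)
have nE i : (n i)%:R = \sum_(k < M.+1) (if (0 < k <= n i)%N then 1 else 0) :> R.
  rewrite -(big_mkord predT (fun k => if (0 < k <= n i)%N then 1 else 0)).
  rewrite big_nat_recl//= add0r (@big_cat_nat _ _ _ (n i))//=.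
  rewrite [X in _ + X](_ : _ = 0) ?addr0; last first.
    by rewrite big_nat_cond big1// => k /andP[/andP[nk _] _]; rewrite ltnNge nk.
  rewrite big_nat_cond (eq_bigr (fun=> 1)) => [|k /andP[/andP[_ kn] _]]; last by rewrite kn.
  by rewrite -big_nat_cond sumr_const_nat subn0.
rewrite /box_volume; under [in RHS]eq_bigr do rewrite nE.
rewrite bigA_distr_bigA mulr_sumr/= big_mkcond; apply: eq_bigr => f _.
case: ifPn => [/forallP f0|/forallPn[i fi]].
  by rewrite big1 ?mulr1// => i _; rewrite f0.
by rewrite (bigD1 i)//= (negbTE fi) mul0r mulr0.
Qed.

Lemma lattice_sumD a b n :
  lattice_sum (fun m => a m + b m) n = lattice_sum a n + lattice_sum b n.
Proof.
by rewrite !(lattice_sum_box _ (fun i => leqnn (n i))) big_split.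
Qed.

End BoxVolume.

(** * Truncation on a block *)

Section BlockDeviation.
Context (disp : measure_display) (T : measurableType disp) (R : realType).
Variable P : probability T R.

Lemma same_distribution_integral (X Y : {RV P >-> R}) (g : R -> R) (K : R) :
  same_distribution X Y -> measurable_fun setT g -> (forall y, `|g y| <= K) ->
  (\int[P]_w (g (X w))%:E = \int[P]_w (g (Y w))%:E)%E.
Proof.
move=> XY mg gK.
have dE (W : {RV P >-> R}) :
    (\int[P]_w (g (W w))%:E = \int[distribution P W]_y (g y)%:E)%E.
  rewrite integral_distribution//; first exact/measurable_EFinP.
  by apply: (@bounded_integrable _ _ _ _ (g \o W) K) => [|w]; [exact: measurableT_comp|exact: gK].
by rewrite !dE; apply: eq_measure_integral => A mA _; exact: XY.
Qed.

Lemma integral_prob_cst (r : R) : (\int[P]_w r%:E = r%:E)%E.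
Proof. by have := expectation_cst P r; rewrite unlock. Qed.

(** Centering at the mean [e] lowers the second moment by [e ^+ 2]. *)
Lemma centered_second_moment_le (f : T -> R) (K e v : R) :
  measurable_fun setT f -> (forall w, `|f w| <= K) ->
  (\int[P]_w (f w)%:E = e%:E)%E -> (\int[P]_w (f w ^+ 2)%:E <= v%:E)%E ->
  (\int[P]_w ((f w - e) ^+ 2)%:E <= v%:E)%E.
Proof.
move=> mf fK fe fv.
have K0 : 0 <= K by apply: le_trans (fK point).
have if1 : P.-integrable setT (EFin \o f) by exact: bounded_integrable fK.
have if2 : P.-integrable setT (EFin \o (fun w => f w ^+ 2)).
  apply: (@bounded_integrable _ _ _ _ _ (K ^+ 2)); first exact: measurable_funX.
  by move=> w; rewrite normrX lerXn2r ?nnegrE.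
have ie (c : R) : P.-integrable setT (EFin \o cst c).
  by apply: (@bounded_integrable _ _ _ _ _ `|c|).
have -> : (\int[P]_w ((f w - e) ^+ 2)%:E = \int[P]_w ((f w ^+ 2)%:E +
    ((- (2 * e))%:E * (f w)%:E + (e ^+ 2)%:E)))%E.
  by apply: eq_integral => w _; rewrite -EFinM -!EFinD; congr EFin; ring.
have i3 : P.-integrable setT (fun w => ((- (2 * e))%:E * (f w)%:E)%E).
  exact: integrableZl.
rewrite integralD//; last by apply: integrableD => //; exact: (ie (e ^+ 2)).
rewrite integralD//; last exact: (ie (e ^+ 2)).
rewrite integralZl// fe integral_prob_cst.
rewrite -[leRHS]adde0; apply: leeD fv _.
by rewrite -EFinM -EFinD lee_fin; have := sqr_ge0 e; lra.
Qed.

Lemma probability_bigsetU_le (J : Type) (s : seq J) (F : J -> set T) :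
  (forall i, measurable (F i)) ->
  (P (\big[setU/set0]_(i <- s) F i) <= \sum_(i <- s) P (F i))%E.
Proof.
move=> mF; elim: s => [|i s IHs]; first by rewrite !big_nil measure0.
rewrite !big_cons (le_trans (measureU2 _ _ _))//; first exact: bigsetU_measurable.
by rewrite leeD2l.
Qed.

Context (d : nat).
Local Notation I := {ffun 'I_d -> nat}.
Context (X : {RV P >-> R}) (xi : I -> {RV P >-> R}).
Hypothesis xi_copies : independent_copies (@posidx d) xi X.

(** Unless some variable of the box leaves [A], which gives the first error term, truncation changes
    no sum. The truncated variables, centered at [e], obey the maximal inequality with Chebyshev's
    bound; replacing [e] by [mu] costs at most [|e - mu|] per index, hence the second term of the
    threshold. *)
Lemma block_deviation (A : set R) (K e v mu x : R) (N : I) :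
  measurable A -> (forall y, A y -> `|y| <= K) -> 0 < x ->
  (\int[P]_w (X w * \1_A (X w))%:E = e%:E)%E ->
  (\int[P]_w ((X w * \1_A (X w)) ^+ 2)%:E <= v%:E)%E ->
  (P (\bigcup_(n in [set n : I | forall i, (n i <= N i)%N])
        [set w | (3 ^+ d * x + box_volume R N * `|e - mu| <=
          `|lattice_sum (fun m => xi m w) n - mu * box_volume R n|)%R]) <=
   (box_volume R N)%:E * P (X @^-1` ~` A) +
   (3 ^+ d * (box_volume R N * v / x ^+ 2))%:E)%E.
Proof.
move=> mA AK x0 Xe Xv; have [ixi dxi] := xi_copies.
pose g (y : R) := y * \1_A y.
have mg : measurable_fun setT g.
  by apply: measurable_funM => //; exact: measurable_indic.
have gK y : `|g y| <= `|K|.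
  rewrite /g indicE; case: (boolP (y \in A)) => [|_]; last by rewrite mulr0 normr0.
  by rewrite inE => /AK yK; rewrite mulr1 (le_trans yK)// ler_norm.
pose Z (m : I) w := g (xi m w) - e.
have mZ m : measurable_fun setT (Z m).
  by apply: measurable_funB => //; exact: measurableT_comp.
have ZK m w : `|Z m w| <= `|K| + `|e|.
  by rewrite (le_trans (ler_normB _ _))// lerD2r gK.
have iZ : mut_indep P (@posidx d) Z.
  move=> J B JD mB.
  have /= := ixi J (fun m => (fun y => g y - e) @^-1` B m) JD; apply => m mJ.
  rewrite -[X in measurable X]setTI.
  by apply: measurable_funB => //; exact: mB.
have Z0 m : posidx m -> (\int[P]_w (Z m w)%:E = 0)%E.
  move=> m0; rewrite /Z; under eq_integral do rewrite EFinB.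
  rewrite integralB//.
  - rewrite (same_distribution_integral (dxi m m0) mg gK) Xe.
    by rewrite integral_prob_cst subee.
  - by apply: (@bounded_integrable _ _ _ _ (g \o xi m) `|K|) => [|w]; [exact: measurableT_comp|exact: gK].
  - by apply: (@bounded_integrable _ _ _ _ (cst e) `|e|).
have Zv m : posidx m -> (\int[P]_w (Z m w ^+ 2)%:E <= v%:E)%E.
  move=> m0; apply: (@centered_second_moment_le (g \o xi m) `|K|).
  - exact: measurableT_comp.
  - by move=> w; exact: gK.
  - by rewrite /= (same_distribution_integral (dxi m m0) mg gK).
  - rewrite /= (same_distribution_integral (g := fun y => g y ^+ 2) (K := `|K| ^+ 2) (dxi m m0))//.
      exact: measurable_funX.
    by move=> y; rewrite normrX lerXn2r ?nnegrE.
have v0 : 0 <= v.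
  by rewrite -lee_fin (le_trans _ Xv)// integral_ge0// => w _; rewrite lee_fin sqr_ge0.
have Sv (n : I) : (forall i, (n i <= N i)%N) ->
    (P [set w | (x <= `|lattice_sum (Z ^~ w) n|)%R] <=
      (box_volume R N * v / x ^+ 2)%:E)%E.
  move=> nN; apply: second_moment_tail => //; first exact: measurable_lattice_sum.
  under eq_integral do rewrite (lattice_sum_box _ (fun i => leqnn (n i))).
  apply: le_trans (second_moment_le _ mZ iZ _ ZK Z0 Zv) _.
    by move=> m; rewrite fset_setK; [case|exact: finite_ord_box].
  rewrite lee_fin ler_wpM2r//.
  rewrite -(lattice_sum_box (fun=> 1) (fun i => leqnn (n i))) lattice_sum_cst mul1r.
  exact: le_box_volume.
have PB := lattice_maximal_ineq mZ iZ Sv.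
set B := \bigcup_(n in _) [set w | (3 ^+ d * x <= _)%R] in PB.
have mB : measurable B.
  by apply: measurable_exceed => n; exact: measurable_lattice_sum.
pose J := fset_set (ord_box N).
have JE m : m \in J -> posidx m.
  by rewrite in_fset_set; [rewrite inE => -[]|exact: finite_ord_box].
pose G := \big[setU/set0]_(m <- J) (xi m @^-1` ~` A).
have mxiA m : measurable (xi m @^-1` ~` A).
  by rewrite -[X in measurable X]setTI; apply: measurable_funPT => //; exact: measurableC.
have mG : measurable G by exact: bigsetU_measurable.
have PG : (P G <= (box_volume R N)%:E * P (X @^-1` ~` A))%E.
  apply: le_trans (probability_bigsetU_le _ mxiA) _.
  rewrite (_ : (\sum_(m <- J) _ = \sum_(m <- J) 1%:E * P (X @^-1` ~` A))%E); last first.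
    rewrite big_seq [RHS]big_seq; apply: eq_bigr => m /JE m0; rewrite mul1e.
    by have := dxi m m0 _ (measurableC mA).
  rewrite -ge0_sume_distrl// sumEFin lee_wpmul2r// lee_fin.
  rewrite -[leRHS]mul1r -lattice_sum_cst (lattice_sum_box _ (fun i => leqnn (N i))).
  rewrite [leRHS]big_seq_cond big_seq -/J le_eqVlt; apply/orP; left; apply/eqP.
  apply: eq_bigl => m; case: (boolP (m \in J)) => //= mJ.
  apply/esym/forallP => i; move: mJ; rewrite in_fset_set; last exact: finite_ord_box.
  by rewrite inE => -[_]; exact.
apply: (@le_trans _ _ (P (G `|` B))); last first.
  by apply: le_trans (measureU2 _ _ _) _ => //; exact: leeD.
apply: le_measure; [apply: mem_set|exact/mem_set/measurableU|].
  apply: measurable_exceed => n; apply: measurable_funB => //.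
  by apply: measurable_lattice_sum.
move=> w [n /= nN]; set S := lattice_sum _ n => xS.
have [Gw|nGw] := pselect (G w); [by left|right].
exists n => //=.
have SE : lattice_sum (Z ^~ w) n = S - e * box_volume R n.
  rewrite -mulNr -lattice_sum_cst -lattice_sumD /S.
  rewrite !(lattice_sum_box _ nN) big_seq_cond [RHS]big_seq_cond.
  apply: eq_bigr => m /andP[mJ _]; rewrite /Z /g indicE mem_set ?mulr1//.
  apply: contrapT => Aw; apply: nGw; rewrite /G -bigcup_seq.
  by exists m.
have -> : lattice_sum (Z ^~ w) n =
    (S - mu * box_volume R n) - (e - mu) * box_volume R n by rewrite SE; ring.
have := lerB_normD (S - mu * box_volume R n) (- ((e - mu) * box_volume R n)).
rewrite normrN normrM (ger0_norm (box_volume_ge0 R n)).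
have := ler_wpM2l (normr_ge0 (e - mu)) (le_box_volume R nN).
by move: xS; lra.
Qed.

End BlockDeviation.

(** * Dyadic moment series *)

Section DyadicMoments.
Context (R : realType).

Lemma logc_ge1 (x : R) : 1 <= logc x.
Proof.
rewrite /logc; case: ltP => // ex.
by rewrite -(expRK 1) ler_ln// posrE ?expR_gt0// (lt_le_trans (expR_gt0 1)).
Qed.

Lemma ln_le_logc (x : R) : ln x <= logc x.
Proof.
rewrite /logc; case: ltP => // xe; have [x0|x0] := ltP 0 x.
  by rewrite -[leRHS]expRK ler_ln ?posrE ?expR_gt0// ltW.
by rewrite ln0.
Qed.

(** Half of the rate [a] absorbs the polynomial, through the term of degree [D.+1] of the
    exponential series; the other half leaves a geometric series. *)
Lemma sum_powers_expR_le (D : nat) (a : R) : 0 < a ->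
  exists Q : R, forall n, \sum_(0 <= i < n) i.+1%:R ^+ D * expR (- (a * i%:R)) <= Q.
Proof.
move=> a0; pose b := a / 2; pose q := expR (- b).
have b0 : 0 < b by rewrite divr_gt0.
have q1 : q < 1 by rewrite /q -expR0 ltr_expR oppr_lt0.
pose c := (D.+1)`!%:R / b ^+ D.+1.
have bD : 0 < b ^+ D.+1 by rewrite exprn_gt0.
exists (c * expR b / (1 - q)) => n.
apply: (@le_trans _ _ (series (geometric (c * expR b) q) n)); last first.
  apply: geometric_le_lim; rewrite ?expR_gt0//.
    by rewrite mulr_ge0 ?expR_ge0// divr_ge0// ltW.
  by rewrite ger0_norm// expR_ge0.
rewrite /series/=; apply: ler_sum_nat => i _.
have h : i.+1%:R ^+ D <= c * expR (b * i.+1%:R).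
  apply: (@le_trans _ _ (i.+1%:R ^+ D.+1)).
    by rewrite exprSr ler_peMr ?exprn_ge0// ler1n.
  have : (b * i.+1%:R) ^+ D.+1 / (D.+1)`!%:R <= expR (b * i.+1%:R).
    have b1 : 0 <= b * i.+1%:R by rewrite mulr_ge0 ?ltW.
    by have := expR_ge1Dxn D b1; lra.
  rewrite ler_pdivrMr ?ltr0n ?fact_gt0// exprMn => h.
  by rewrite /c mulrAC ler_pdivlMr// mulrC [leRHS]mulrC.
apply: (@le_trans _ _ (c * expR (b * i.+1%:R) * expR (- (a * i%:R)))).
  by rewrite ler_wpM2r ?expR_ge0.
rewrite -!mulrA /q -expRM_natr -!expRD le_eqVlt; apply/orP; left; apply/eqP.
by congr (_ * (_ * expR _)); rewrite -natr1 /b; field.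
Qed.

Variables (beta : R) (beta_range : 1 <= beta < 2).

Definition dyadic_radius (j : nat) : R := (2 ^+ j) `^ beta^-1.

Definition dyadic_level (j : nat) : set R := [set y | `|y| <= dyadic_radius j].

Let beta_gt0 : 0 < beta. Proof. by have /andP[] := beta_range; lra. Qed.

Lemma dyadic_radius_gt0 j : 0 < dyadic_radius j.
Proof. by rewrite powR_gt0// exprn_gt0. Qed.

Lemma dyadic_radius_powR j : dyadic_radius j `^ beta = 2 ^+ j.
Proof. by rewrite -powRrM mulVf ?gt_eqF// powRr1// exprn_ge0. Qed.

Lemma dyadic_radius_expR j : dyadic_radius j = expR (ln 2 / beta * j%:R).
Proof.
rewrite /dyadic_radius -powR_mulrn// -powRrM -[in LHS](@lnK _ 2) ?posrE// -expRM.
by congr expR; ring.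
Qed.

(* The integrand of the two error terms of [block_deviation] for truncation at
   [dyadic_radius j]; the first factor bounds the number of dyadic blocks of
   volume [2 ^+ j]. *)
Definition dyadic_cost (D j : nat) (y : R) : R :=
  j.+1%:R ^+ D * (2 ^+ j * \1_(~` dyadic_level j) y +
    2 ^+ j / dyadic_radius j ^+ 2 * (y * \1_(dyadic_level j) y) ^+ 2).

Lemma dyadic_cost_ge0 D j y : 0 <= dyadic_cost D j y.
Proof.
rewrite /dyadic_cost mulr_ge0 ?exprn_ge0// addr_ge0//.
by rewrite mulr_ge0 ?sqr_ge0// divr_ge0 ?sqr_ge0 ?exprn_ge0.
Qed.

(** The [2] bounds [beta]; the [1], multiplied by a value of [logc], pays for passing from [j] to
    [j.+1]. *)
Let c0 : R := 1 + 2 / ln 2.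

Let c0_ge1 : 1 <= c0.
Proof. by rewrite /c0 lerDl divr_ge0// ln_ge0// ler1n. Qed.

Lemma dyadic_radius_lt_logc j (y : R) : dyadic_radius j < `|y| ->
  j.+1%:R <= c0 * logc `|y|.
Proof.
move=> ry; have y0 : 0 < `|y| by rewrite (lt_trans (dyadic_radius_gt0 j)).
have ln2 : 0 < ln 2 :> R by rewrite ln_gt0// ltr1n.
have : ln 2 / beta * j%:R < ln `|y|.
  by rewrite -[ltLHS]expRK -dyadic_radius_expR ltr_ln ?posrE// dyadic_radius_gt0.
rewrite mulrAC ltr_pdivrMr// => jy.
have L1 := logc_ge1 `|y|; have yL := ln_le_logc `|y|.
have jL : j%:R <= 2 / ln 2 * logc `|y|.
  rewrite mulrAC ler_pdivlMr// mulrC (le_trans (ltW jy))// mulrC.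
  apply: (@le_trans _ _ (beta * logc `|y|)); first by rewrite ler_wpM2l// ltW.
  by rewrite ler_wpM2r ?(le_trans ler01)//; have /andP[_ /ltW] := beta_range.
by rewrite /c0 mulrDl mul1r -natr1; lra.
Qed.

(** Let [J] be the first index with radius at least [|y|]. The first part of the cost lives before
    [J] and grows geometrically, the second lives from [J] on and decays geometrically. Both are
    thus dominated near [J], where [j.+1] is at most of order [logc |y|]. *)
Lemma dyadic_cost_sum_le (D : nat) : exists C : R, forall n (y : R),
  \sum_(0 <= j < n) dyadic_cost D j y <= C * (`|y| `^ beta * logc `|y| ^+ D).
Proof.
have ln2 : 0 < ln 2 :> R by rewrite ln_gt0// ltr1n.
pose g : R := ln 2 / beta; pose a := (2 - beta) * g.
have a0 : 0 < a.
  by rewrite mulr_gt0 ?divr_gt0// subr_gt0; have /andP[] := beta_range.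
have [Q hQ] := sum_powers_expR_le D a0.
have Q0 : 0 <= Q by have := hQ 0%N; rewrite big_geq.
exists (2 * c0 ^+ D + (2 * c0) ^+ D * Q) => n y.
set u := `|y| `^ beta; set L := logc `|y|.
have L1 : 1 <= L by exact: logc_ge1.
have L0 : 0 <= L by exact: le_trans L1.
have c00 : 0 <= c0 by exact: le_trans c0_ge1.
have u0 : 0 <= u by exact: powR_ge0.
have big_u j : dyadic_radius j < `|y| -> 2 ^+ j <= u.
  move=> ry; rewrite -dyadic_radius_powR ltW// gt0_ltr_powR// nnegrE//.
  by rewrite ltW// dyadic_radius_gt0.
under eq_bigr do rewrite /dyadic_cost mulrDr.
rewrite big_split/= mulrDl lerD//.
  apply: (@le_trans _ _ ((c0 * L) ^+ D * \sum_(0 <= j < n) (2 ^+ j * \1_(~` dyadic_level j) y))).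
    rewrite mulr_sumr; apply: ler_sum_nat => j _.
    rewrite indicE; case: (boolP (y \in _)) => [|_]; last by rewrite !mulr0.
    rewrite inE => /negP; rewrite -ltNge => ry.
    rewrite ler_wpM2r ?mulr_ge0 ?exprn_ge0// lerXn2r ?nnegrE ?mulr_ge0//.
    exact: dyadic_radius_lt_logc.
  (* The bound by [2 ^+ n] carries the induction: a new nonzero term [2 ^+ n] is at most [u], and
     the earlier terms together are at most [2 ^+ n]. *)
  have h2 : \sum_(0 <= j < n) (2 ^+ j * \1_(~` dyadic_level j) y) <= 2 * u /\
         \sum_(0 <= j < n) (2 ^+ j * \1_(~` dyadic_level j) y) <= (2 ^+ n : R).
    elim: n => [|n [IH1 IH2]]; first by rewrite big_geq// mulr_ge0 ?exprn_ge0.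
    rewrite big_nat_recr//= indicE exprS; case: (boolP (y \in _)) => [|_].
      rewrite inE => /negP; rewrite -ltNge => /big_u un.
      by rewrite mulr1; split; lra.
    have : 0 <= 2 ^+ n :> R by rewrite exprn_ge0.
    by rewrite mulr0 addr0; split; lra.
  apply: (@le_trans _ _ ((c0 * L) ^+ D * (2 * u))).
    by rewrite ler_wpM2l ?exprn_ge0 ?mulr_ge0//; case: h2.
  by rewrite exprMn le_eqVlt; apply/orP; left; apply/eqP; ring.
pose W := (2 * c0 * L) ^+ D * u.
have W0 : 0 <= W by rewrite mulr_ge0 ?exprn_ge0 ?mulr_ge0.
rewrite (_ : (2 * c0) ^+ D * Q * (u * L ^+ D) = W * Q); last first.
  by rewrite /W [(2 * c0 * L) ^+ D]exprMn; ring.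
have [[j0 yj0]|noj] := pselect (exists j, `|y| <= dyadic_radius j); last first.
  rewrite big1 ?(mulr_ge0 W0 Q0)// => j _; rewrite indicE memNset ?mulr0 ?expr0n ?mulr0//.
  by move=> yj; apply: noj; exists j.
have [J yJ Jmin] := ex_minnP (ex_intro (fun j => `|y| <= dyadic_radius j) j0 yj0).
(* If [J] is positive, the preceding radius is below [|y|], which bounds [J]; the factor [2] pays
   for the shift by one. *)
have JL : J.+1%:R <= 2 * c0 * L.
  have cL : 1 <= c0 * L by rewrite mulr_ege1.
  case: J {yJ} Jmin => [|J] Jmin; first by lra.
  have : J.+1%:R <= c0 * L.
    apply: dyadic_radius_lt_logc; rewrite ltNge; apply/negP => /Jmin.
    by rewrite ltnn.
  by rewrite -(natr1 J.+1); lra.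
pose f i := i.+1%:R ^+ D * expR (- (a * i%:R)).
have f0 i : 0 <= f i by rewrite mulr_ge0 ?exprn_ge0 ?expR_ge0.
apply: (@le_trans _ _ (W * \sum_(0 <= j < n) (if (J <= j)%N then f (j - J)%N else 0))).
  rewrite mulr_sumr; apply: ler_sum_nat => j _.
  rewrite indicE; case: (boolP (y \in dyadic_level j)) => [|_]; last first.
    by rewrite mulr0 expr0n/= !mulr0; case: ifP; rewrite ?mulr0// (mulr_ge0 W0 (f0 _)).
  rewrite inE => /= yj; have Jj := Jmin _ yj; rewrite Jj mulr1.
  pose i := (j - J)%N; have jE : j = (i + J)%N by rewrite subnK.
  have y2 : y ^+ 2 <= u * dyadic_radius J `^ (2 - beta).
    have -> : y ^+ 2 = u * `|y| `^ (2 - beta).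
      rewrite -real_normK ?num_real// /u -powRD; last by apply/implyP => /eqP; lra.
      by rewrite -powR_mulrn//; congr (_ `^ _); ring.
    rewrite ler_wpM2l// ge0_ler_powR ?nnegrE//.
      by have /andP[_ /ltW] := beta_range; rewrite subr_ge0.
    by rewrite ltW// dyadic_radius_gt0.
  (* Since [2 ^+ j] is the radius at [j] to the power [beta], the left side is the ratio of the
     radii at [J] and [j] to the power [2 - beta], which decays because [beta < 2]. *)
  have E : 2 ^+ j / dyadic_radius j ^+ 2 * dyadic_radius J `^ (2 - beta) = expR (- (a * i%:R)).
    rewrite -dyadic_radius_powR -powR_mulrn ?(ltW (dyadic_radius_gt0 _))//.
    rewrite -powRN !dyadic_radius_expR -!expRM -!expRD jE natrD /a /g.
    by congr expR; field; rewrite gt_eqF.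
  apply: (@le_trans _ _ (j.+1%:R ^+ D * (u * expR (- (a * i%:R))))).
    rewrite ler_wpM2l ?exprn_ge0// -E.
    have q0 : 0 <= 2 ^+ j / dyadic_radius j ^+ 2 :> R.
      by apply: divr_ge0; [exact: exprn_ge0|exact: sqr_ge0].
    by apply: le_trans (ler_wpM2l q0 y2) _; rewrite mulrCA.
  rewrite (_ : W * f _ = (2 * c0 * L * i.+1%:R) ^+ D * (u * expR (- (a * i%:R)))); last first.
    by rewrite /W /f -/i [in RHS]exprMn; ring.
  rewrite ler_wpM2r ?mulr_ge0 ?expR_ge0// lerXn2r ?nnegrE ?mulr_ge0//.
  apply: (@le_trans _ _ (J.+1%:R * i.+1%:R)); last by rewrite ler_wpM2r.
  by rewrite -natrM ler_nat jE mulSn addSn ltnS leq_add2l leq_pmulr.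
rewrite ler_wpM2l//.
have [nJ|Jn] := leqP n J.
  by rewrite big_nat_cond big1// => j /andP[/andP[_ jn] _]; rewrite leqNgt (leq_trans jn).
rewrite (@big_cat_nat _ _ _ J)//= ?(ltnW Jn)// big_nat_cond big1 ?add0r => [|j /andP[/andP[_ jJ] _]]; last first.
  by rewrite leqNgt jJ.
rewrite -{1}[J]add0n big_addn; apply: le_trans (hQ (n - J)%N).
by apply: ler_sum_nat => i _; rewrite leq_addl addnK.
Qed.

End DyadicMoments.

(** * Consequences of the moment condition for truncations *)

Section TruncatedMoments.
Context (disp : measure_display) (T : measurableType disp) (R : realType).
Variable P : probability T R.
Variables (X : {RV P >-> R}) (beta : R).
Hypothesis beta_range : 1 <= beta < 2.

Lemma measurable_logc : measurable_fun setT (@logc R).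
Proof.
rewrite (_ : @logc R = fun x => Num.max 1 (ln x)).
  by apply: measurable_maxr => //; exact: measurable_ln.
apply/funext => x; apply/esym; have := logc_ge1 x; have := ln_le_logc x.
rewrite /logc; case: ifP => _ h1 h2; first exact/max_idPl.
exact/max_idPr.
Qed.

Lemma measurable_dyadic_level j : measurable (dyadic_level beta j).
Proof.
rewrite (_ : dyadic_level beta j = setT `&` (fun y : R => `|y|) @^-1` `]-oo, dyadic_radius beta j]).
  by apply: measurableT_comp.
by apply/seteqP; split => y /=; rewrite in_itv/=; tauto.
Qed.

Lemma measurable_dyadic_cost D j : measurable_fun setT (dyadic_cost beta D j).
Proof.
have mA := measurable_dyadic_level j.
apply: measurable_funM => //; apply: measurable_funD.
  by apply: measurable_funM => //; apply: measurable_indic; exact: measurableC.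
apply: measurable_funM => //; apply: measurable_funX; exact: measurable_funM.
Qed.

Variable D : nat.
Hypothesis X_moment :
  ('E_P[fun w => (`|X w| `^ beta * logc `|X w| ^+ D)%R] < +oo)%E.

Let mom w : R := `|X w| `^ beta * logc `|X w| ^+ D.

Let measurable_mom : measurable_fun setT mom.
Proof.
have mX : measurable_fun setT (fun w => `|X w|) by exact: measurableT_comp.
apply: measurable_funM.
  by apply: (measurableT_comp (measurable_powR beta)).
by apply: measurable_funX; apply: (measurableT_comp measurable_logc).
Qed.

Let mom_ge0 w : 0 <= mom w.
Proof. by rewrite mulr_ge0 ?powR_ge0// exprn_ge0// (le_trans ler01)// logc_ge1. Qed.

Let mom_lty : (\int[P]_w (mom w)%:E < +oo)%E.
Proof. by move: X_moment; rewrite unlock. Qed.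

(** Sum and integral are exchanged and the bound of [dyadic_cost_sum_le] is integrated; its constant
    comes without a sign, hence [|C|]. *)
Lemma dyadic_cost_summable :
  (\sum_(0 <= j <oo) \int[P]_w (dyadic_cost beta D j (X w))%:E < +oo)%E.
Proof.
have mc j : measurable_fun setT (fun w => (dyadic_cost beta D j (X w))%:E).
  by apply/measurable_EFinP; apply: measurableT_comp => //; exact: measurable_dyadic_cost.
rewrite -integral_nneseries//; last by move=> j w _; rewrite lee_fin dyadic_cost_ge0.
have [C hC] := dyadic_cost_sum_le beta_range D.
apply: (@le_lt_trans _ _ (\int[P]_w (`|C|%:E * (mom w)%:E))%E); last first.
  rewrite ge0_integralZl//; first by rewrite lte_mul_pinfty.
  - exact/measurable_EFinP.
  - by move=> w _; rewrite lee_fin.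
apply: ge0_le_integral => //.
- by move=> w _; apply: nneseries_ge0 => j _ _; rewrite lee_fin dyadic_cost_ge0.
- by apply: ge0_emeasurable_sum => // j w _ _; rewrite lee_fin dyadic_cost_ge0.
- by apply/measurable_EFinP; exact: measurable_funM.
- move=> w _; apply: lime_le.
    by apply: is_cvg_nneseries => j _ _; rewrite lee_fin dyadic_cost_ge0.
  apply: nearW => n; rewrite sumEFin -EFinM lee_fin.
  by apply: (le_trans (hC n (X w))); rewrite ler_wpM2r ?ler_norm// mom_ge0.
Qed.

Lemma dyadic_radius_pinfty (y : R) : \forall j \near \oo, y <= dyadic_radius beta j.
Proof.
have b0 : 0 < beta by have /andP[] := beta_range; lra.
have g0 : 0 < ln 2 / beta by rewrite divr_gt0// ln_gt0// ltr1n.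
exists (Num.truncn (y / (ln 2 / beta))).+1 => // j /= yj.
rewrite dyadic_radius_expR//; apply: le_trans (expR_ge1Dx _).
have : y / (ln 2 / beta) <= j%:R.
  by rewrite ltW// (lt_le_trans (truncnS_gt _))// ler_nat.
by rewrite ler_pdivrMr// mulrC; lra.
Qed.

Let pow_tail j w : R := `|X w| `^ beta * \1_(~` dyadic_level beta j) (X w).

(** Where [|X|] exceeds the radius r, it is at most r^(1-beta) |X|^beta, and r^(1-beta) = r / 2^j.
    So the bias accumulated over a volume 2^j is at most r times the tail of the moment of order
    [beta], which vanishes by dominated convergence. *)
Lemma truncated_mean_cvg (mu : R) (e : nat -> R) :
  P.-integrable setT (EFin \o X) -> (\int[P]_w (X w)%:E = mu%:E)%E ->
  (forall j, (\int[P]_w (X w * \1_(dyadic_level beta j) (X w))%:E = (e j)%:E)%E) ->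
  forall eta : R, 0 < eta ->
  \forall j \near \oo, 2 ^+ j * `|e j - mu| <= eta * dyadic_radius beta j.
Proof.
move=> iX Xmu Xe eta eta0.
have b0 : 0 < beta by have /andP[] := beta_range; lra.
have b1 : 1 <= beta by have /andP[] := beta_range.
have mtail j : measurable_fun setT (pow_tail j).
  apply: measurable_funM.
    apply: (measurableT_comp (measurable_powR beta)).
    by apply: measurableT_comp.
  apply: (measurableT_comp (measurable_indic _)) => //.
  by apply: measurableC; exact: measurable_dyadic_level.
have tail_mom j w : 0 <= pow_tail j w <= mom w.
  rewrite /pow_tail /mom mulr_ge0 ?powR_ge0//= ler_wpM2l ?powR_ge0//.
  apply: (@le_trans _ _ 1); first by rewrite indicE; case: (_ \in _).
  by rewrite exprn_ege1// logc_ge1.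
have imom : P.-integrable setT (EFin \o mom).
  apply/integrableP; split; first exact/measurable_EFinP.
  by under eq_integral do rewrite /= ger0_norm//.
have tail0 : (\int[P]_w (pow_tail j w)%:E @[j --> \oo] --> (\int[P]_w (cst 0 w))%E)%E.
  apply: (@dominated_cvg _ _ _ P setT measurableT (fun j w => (pow_tail j w)%:E) (cst 0%E) (EFin \o mom)) => //.
  - by move=> j; exact/measurable_EFinP.
  - move=> w _; apply: cvg_near_cst; near=> j.
    rewrite /pow_tail indicE memNset ?mulr0// => /=; apply; rewrite /dyadic_level/=.
    by near: j; exact: dyadic_radius_pinfty.
  - move=> j w _; have /andP[t0 tm] := tail_mom j w.
    by rewrite /= lee_fin ger0_norm.
rewrite integral0 in tail0.
have /fine_cvgP[_ /cvgrPdist_le/(_ eta eta0)] := tail0.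
apply: filterS => j /=; rewrite sub0r normrN => tj.
have m1 : measurable_fun setT (fun w => X w * \1_(dyadic_level beta j) (X w)).
  apply: measurable_funM => //; apply: (measurableT_comp (measurable_indic _)) => //.
  exact: measurable_dyadic_level.
have i1 : P.-integrable setT (EFin \o (fun w => X w * \1_(dyadic_level beta j) (X w))).
  apply: (@bounded_integrable _ _ _ _ _ (dyadic_radius beta j)) => // w.
  rewrite indicE; case: (boolP (_ \in _)) => [|_].
    by rewrite inE mulr1.
  by rewrite mulr0 normr0 ltW// dyadic_radius_gt0.
have it : P.-integrable setT (EFin \o pow_tail j).
  apply: (le_integrable measurableT _ _ imom); first exact/measurable_EFinP.
  move=> w _; have /andP[t0 tm] := tail_mom j w.
  by rewrite /= lee_fin !ger0_norm.
have ediff : ((e j - mu)%:E = \int[P]_w (X w * \1_(dyadic_level beta j) (X w) - X w)%:E)%E.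
  under eq_integral do rewrite EFinB.
  by rewrite integralB// Xe Xmu EFinB.
have i2 : P.-integrable setT (fun w => (X w * \1_(dyadic_level beta j) (X w) - X w)%:E).
  by under eq_fun do rewrite EFinB; exact: integrableB.
have : (`|(e j - mu)%:E| <= (dyadic_radius beta j / 2 ^+ j)%:E * \int[P]_w (pow_tail j w)%:E)%E.
  rewrite ediff; apply: le_trans (le_abse_integral _ _ _) _ => //.
    by have /integrableP[] := i2.
  rewrite -integralZl//; apply: ge0_le_integral => //.
  - by apply: measurableT_comp => //; have /integrableP[] := i2.
  - by apply: emeasurable_funM => //; exact/measurable_EFinP.
  move=> w _; rewrite -EFinM lee_fin /pow_tail !indicE.
  case: (boolP (X w \in dyadic_level beta j)) => [|nXj].
    rewrite inE => Xj; rewrite memNset; last by move=> /(_ Xj).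
    by rewrite mulr1 subrr normr0 !mulr0.
  have Xr : dyadic_radius beta j < `|X w|.
    by move: nXj; rewrite notin_setE => /negP; rewrite -ltNge.
  rewrite mem_set; last by move: nXj; rewrite notin_setE.
  rewrite mulr0 sub0r normrN mulr1.
  have r0 := dyadic_radius_gt0 beta j.
  rewrite -(@dyadic_radius_powR _ _ beta_range) mulrAC ler_pdivlMr ?powR_gt0//.
  have X0 : 0 < `|X w| by exact: lt_trans Xr.
  rewrite -[X in X * _ <= _]powRr1// -[X in _ <= X * _]powRr1 ?(ltW r0)//.
  (* Cancelling one power leaves the monotonicity of the power [beta - 1], which is nonnegative. *)
  have split_beta x : 0 < x -> x `^ beta = x `^ 1 * x `^ (beta - 1).
    by move=> x0; rewrite -powRD ?subrKC//; apply/implyP; rewrite gt_eqF.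
  rewrite !split_beta// mulrA [leRHS]mulrA [_ `^ 1 * _ `^ 1]mulrC ler_wpM2l ?mulr_ge0 ?powR_ge0//.
  by apply: ge0_ler_powR; rewrite ?subr_ge0 ?nnegrE// ltW.
have tfin : (\int[P]_w (pow_tail j w)%:E)%E \is a fin_num by exact: integrable_fin_num.
rewrite -(fineK tfin) -EFinM /= lee_fin => h.
have p2 : 0 < 2 ^+ j :> R by rewrite exprn_gt0.
have := ler_wpM2l (ltW p2) h; move/le_trans; apply.
rewrite mulrA mulrCA divff ?gt_eqF// mulr1 mulrC ler_wpM2r ?(ltW (dyadic_radius_gt0 _ _))//.
exact: le_trans (ler_norm _) tj.
Unshelve. all: by end_near. Qed.

End TruncatedMoments.

(** Given the total [j], the entries other than the first determine the first. This counts the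
    dyadic blocks of volume [2 ^+ j] in dimension [D.+1]. *)
Lemma card_ffun_sum (D j : nat) :
  (#|[set k : {ffun 'I_D.+1 -> 'I_j.+1} | (\sum_i k i)%N == j]%SET| <= j.+1 ^ D)%N.
Proof.
pose tl (k : {ffun 'I_D.+1 -> 'I_j.+1}) : {ffun 'I_D -> 'I_j.+1} := [ffun i : 'I_D => k (lift ord0 i)].
rewrite -(@card_in_imset _ _ tl) => [|k l].
  by apply: leq_trans (max_card _) _; rewrite card_ffun !card_ord.
rewrite !inE !big_ord_recl => /eqP kj /eqP lj /ffunP kl; apply/ffunP => i.
have kli i' : k (lift ord0 i') = l (lift ord0 i') by have := kl i'; rewrite !ffunE.
case: (unliftP ord0 i) => [i' ->|->]; first exact: kli.
apply/val_inj => /=; move: kj; rewrite -[RHS]lj.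
by under eq_bigr do rewrite kli; move/addIn.
Qed.

(** * Strong law on the lattice *)

Section StrongLaw.
Context (disp : measure_display) (T : measurableType disp) (R : realType).
Variable P : probability T R.
Context (D : nat).
Local Notation d := D.+1.
Local Notation I := {ffun 'I_d -> nat}.
Context (X : {RV P >-> R}) (xi : I -> {RV P >-> R}).
Hypothesis xi_copies : independent_copies (@posidx d) xi X.
Hypothesis X_integrable : P.-integrable [set: T] (EFin \o X).
Variables (mu beta : R).
Hypothesis mu_mean : 'E_P[X]%E = mu%:E.
Hypothesis beta_range : 1 <= beta < 2.
Hypothesis X_moment :
  ('E_P[fun w => (`|X w| `^ beta * logc `|X w| ^+ D)%R] < +oo)%E.

Local Notation S n w := (lattice_sum (fun m => xi m w) n).
Local Notation radius := (dyadic_radius beta).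
Local Notation level := (dyadic_level beta).

(** Upper corner of the dyadic block [2 ^ k i <= n i < 2 ^ (k i).+1]. The bound [j] on the entries
    of [k] loses nothing when they sum to [j]. *)
Definition dyadic_corner (j : nat) (k : {ffun 'I_d -> 'I_j.+1}) : I :=
  [ffun i => 2 ^ (k i).+1]%N.

Lemma dyadic_corner_volume j (k : {ffun 'I_d -> 'I_j.+1}) :
  (\sum_i k i)%N = j -> box_volume R (dyadic_corner k) = 2 ^+ (j + d).
Proof.
move=> kj; rewrite /box_volume.
under eq_bigr do rewrite ffunE natrX.
rewrite prodrXr; congr (_ ^+ _).
under eq_bigr do rewrite -addn1.
by rewrite big_split/= kj sum_nat_const card_ord muln1.
Qed.

Definition block_event (eta : R) (j : nat) (k : {ffun 'I_d -> 'I_j.+1}) : set T :=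
  \bigcup_(n in [set n : I | forall i, (n i <= dyadic_corner k i)%N])
    [set w | eta * radius j <= `|S n w - mu * box_volume R n|].

Lemma measurable_block_event eta j (k : {ffun 'I_d -> 'I_j.+1}) :
  measurable (block_event eta k).
Proof.
apply: measurable_exceed => n; apply: measurable_funB => //.
exact: measurable_lattice_sum.
Qed.

(** Half of [eta] goes to the random deviation, half to the truncation bias. The weight on the left,
    already part of [dyadic_cost], will cancel the number of blocks. *)
Lemma block_event_le (eta : R) : 0 < eta -> exists2 C : R, 0 <= C &
  \forall j \near \oo, forall k : {ffun 'I_d -> 'I_j.+1}, (\sum_i k i)%N = j ->
    ((j.+1%:R ^+ D)%:E * P (block_event eta k) <=
     C%:E * \int[P]_w (dyadic_cost beta D j (X w))%:E)%E.
Proof.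
(* After the factor [3 ^+ d] of the maximal inequality, [delta] becomes [eta / 2]. *)
move=> eta0; pose delta := eta / (2 * 3 ^+ d).
have delta0 : 0 < delta by rewrite divr_gt0// mulr_gt0// exprn_gt0.
have mlev j := measurable_dyadic_level beta j.
pose trunc j w := X w * \1_(level j) (X w).
have mtrunc j : measurable_fun setT (trunc j).
  by apply: measurable_funM => //; apply: (measurableT_comp (measurable_indic _)).
have trunc_le j w : `|trunc j w| <= radius j.
  rewrite /trunc indicE; case: (boolP (_ \in _)) => [|_]; first by rewrite inE mulr1.
  by rewrite mulr0 normr0 ltW// dyadic_radius_gt0.
have itrunc j : P.-integrable setT (EFin \o trunc j).
  exact: bounded_integrable (trunc_le j).
have itrunc2 j : P.-integrable setT (EFin \o (fun w => trunc j w ^+ 2)).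
  apply: (@bounded_integrable _ _ _ _ _ (radius j ^+ 2)); first exact: measurable_funX.
  by move=> w; rewrite normrX lerXn2r ?nnegrE// ltW// dyadic_radius_gt0.
pose e j := fine (\int[P]_w (trunc j w)%:E)%E.
pose v j := fine (\int[P]_w (trunc j w ^+ 2)%:E)%E.
have eE j : (\int[P]_w (trunc j w)%:E = (e j)%:E)%E.
  by rewrite fineK//; exact: integrable_fin_num (itrunc j).
have vE j : (\int[P]_w (trunc j w ^+ 2)%:E = (v j)%:E)%E.
  by rewrite fineK//; exact: integrable_fin_num (itrunc2 j).
have v0 j : 0 <= v j.
  by rewrite fine_ge0// integral_ge0// => w _; rewrite lee_fin sqr_ge0.
have mu_int : (\int[P]_w (X w)%:E = mu%:E)%E by move: mu_mean; rewrite unlock.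
(* [2 ^+ d] comes from the volume [2 ^+ (j + d)] of the corner box; the bracket dominates the
   coefficients [1] and [3 ^+ d / delta ^+ 2] of the two parts of the cost. *)
pose C : R := 2 ^+ d * (1 + 3 ^+ d / delta ^+ 2).
have C0 : 0 <= C.
  by rewrite mulr_ge0 ?exprn_ge0// addr_ge0// divr_ge0 ?exprn_ge0// ltW.
exists C => //.
(* The bias is also summed over that volume, so its share [eta / 2] is divided by [2 ^+ d]. *)
have eta'0 : 0 < eta / (2 * 2 ^+ d) by rewrite divr_gt0// mulr_gt0// exprn_gt0.
have := truncated_mean_cvg beta_range X_moment X_integrable mu_int eE eta'0.
apply: filterS => j ej k kj.
have r0 := dyadic_radius_gt0 beta j.
pose q := fine (P (X @^-1` ~` level j)).
have mXl : measurable (X @^-1` ~` level j).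
  by rewrite -[X in measurable X]setTI; apply: measurable_funPT => //; exact: measurableC.
have qE : P (X @^-1` ~` level j) = q%:E by rewrite fineK// fin_num_measure.
have q0 : 0 <= q by rewrite fine_ge0.
have costE : (\int[P]_w (dyadic_cost beta D j (X w))%:E =
    (j.+1%:R ^+ D * (2 ^+ j * q + 2 ^+ j / radius j ^+ 2 * v j))%:E)%E.
  rewrite /dyadic_cost; under eq_integral do rewrite EFinM EFinD 2!EFinM.
  have i1 : P.-integrable setT (EFin \o (fun w => \1_(~` level j) (X w))).
    apply: (@bounded_integrable _ _ _ _ _ 1) => [|w].
      by apply: (measurableT_comp (measurable_indic _)) => //; exact: measurableC.
    by rewrite indicE; case: (_ \in _); rewrite ?normr1 ?normr0.
  have i2 : P.-integrable setT (fun w => (2 ^+ j)%:E * (\1_(~` level j) (X w))%:E)%E.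
    exact: (integrableZl measurableT (2 ^+ j) i1).
  have i3 : P.-integrable setT
      (fun w => (2 ^+ j / radius j ^+ 2)%:E * ((X w * \1_(level j) (X w)) ^+ 2)%:E)%E.
    exact: (integrableZl measurableT (2 ^+ j / radius j ^+ 2) (itrunc2 j)).
  rewrite integralZl//; last exact: (integrableD measurableT i2 i3).
  rewrite (integralD measurableT i2 i3).
  rewrite (integralZl measurableT i1) (integralZl measurableT (itrunc2 j)) /= vE.
  rewrite (_ : (\int[P]_w (\1_(~` level j) (X w))%:E = q%:E)%E).
    by [].
  transitivity (\int[P]_w (\1_(X @^-1` ~` level j) w)%:E)%E; last first.
    by rewrite integral_indic// setIT.
  by apply: eq_integral.
rewrite costE.
have bd := @block_deviation _ _ _ P _ X xi xi_copies (level j) (radius j) (e j)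
  (v j) mu (delta * radius j) (dyadic_corner k) (mlev j) _ _ (eE j) _.
have {}bd := bd (fun y yl => yl) (mulr_gt0 delta0 r0).
rewrite vE lexx in bd; have {bd} := bd isT.
rewrite (dyadic_corner_volume kj) qE => bd.
have Pk : (P (block_event eta k) <=
    (2 ^+ (j + d) * q + 3 ^+ d * (2 ^+ (j + d) * v j / (delta * radius j) ^+ 2))%:E)%E.
  rewrite EFinD EFinM; apply: le_trans bd.
  apply: le_measure; [exact/mem_set/measurable_block_event|apply: mem_set|].
    apply: measurable_exceed => n; apply: measurable_funB => //.
    exact: measurable_lattice_sum.
  move=> w [n nk /= h]; exists n => //=; apply: le_trans h.
  rewrite exprD (_ : eta * radius j = 3 ^+ d * (delta * radius j) + 2 ^+ d * (eta / (2 * 2 ^+ d) * radius j)); last first.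
    by rewrite /delta; field; rewrite !expf_neq0 ?pnatr_eq0.
  by rewrite lerD2l mulrAC mulrC ler_wpM2l ?exprn_ge0// mulrC.
apply: (le_trans (lee_wpmul2l _ Pk)); first by rewrite lee_fin exprn_ge0.
rewrite -!EFinM lee_fin [leRHS]mulrCA ler_wpM2l ?exprn_ge0//.
have -> : 2 ^+ (j + d) * q + 3 ^+ d * (2 ^+ (j + d) * v j / (delta * radius j) ^+ 2) =
    2 ^+ d * (1 * (2 ^+ j * q) + 3 ^+ d / delta ^+ 2 * (2 ^+ j / radius j ^+ 2 * v j)).
  by rewrite exprD; field; rewrite ?gt_eqF.
rewrite /C -[leRHS]mulrA ler_wpM2l ?exprn_ge0// mulrDr.
have a0 : 0 <= 2 ^+ j * q by rewrite mulr_ge0 ?exprn_ge0.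
have b0 : 0 <= 2 ^+ j / radius j ^+ 2 * v j.
  by rewrite mulr_ge0// divr_ge0 ?exprn_ge0// ltW.
have c0 : 0 <= 3 ^+ d / delta ^+ 2 by rewrite divr_ge0 ?exprn_ge0// ltW.
by apply: lerD; rewrite ler_wpM2r// ?lerDl// lerDr.
Qed.

Lemma lattice_sum_eq0 (a : I -> R) (n : I) i : n i = 0%N -> lattice_sum a n = 0.
Proof.
move=> ni0; rewrite (lattice_sum_box _ (fun i => leqnn (n i))) big_seq_cond big1// => m.
rewrite in_fset_set; last exact: finite_ord_box.
move=> /andP[/set_mem[m0 mn] _].
by have := leq_trans (m0 i) (mn i); rewrite ni0.
Qed.

(** The integer parts of the binary logarithms of the entries select the block of [n]. Then [2 ^+ j]
    is at most the volume of [n], so the radius is at most |n|^(1/beta). *)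
Lemma block_event_cover (eta : R) (w : T) (n : I) : 0 < eta -> posidx n ->
  (forall k : {ffun 'I_d -> 'I_(\sum_i trunc_log 2 (n i)).+1},
    (\sum_i k i)%N = (\sum_i trunc_log 2 (n i))%N -> ~ block_event eta k w) ->
  `|S n w - mu * box_volume R n| <= eta * box_volume R n `^ beta^-1.
Proof.
move=> eta0 n0; set j := (\sum_i trunc_log 2 (n i))%N => nk.
have b0 : 0 < beta by have /andP[] := beta_range; lra.
have kj i : (trunc_log 2 (n i) <= j)%N by rewrite /j (bigD1 i)//= leq_addr.
pose k : {ffun 'I_d -> 'I_j.+1} := [ffun i => inord (trunc_log 2 (n i))].
have kE i : k i = trunc_log 2 (n i) :> nat by rewrite ffunE inordK// ltnS.
have kS : (\sum_i k i)%N = j by apply: eq_bigr => i _; rewrite kE.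
have nr : `|S n w - mu * box_volume R n| < eta * radius j.
  rewrite ltNge; apply/negP => h; apply: (nk k kS); exists n => //= i.
  by rewrite ffunE kE ltnW// trunc_log_ltn.
apply: (le_trans (ltW nr)); rewrite ler_wpM2l ?(ltW eta0)//.
apply: ge0_ler_powR; rewrite ?nnegrE ?invr_ge0 ?exprn_ge0 ?box_volume_ge0 ?(ltW b0)//.
rewrite /j -prodrXr; apply: ler_prod => i _.
by rewrite exprn_ge0//= -natrX ler_nat trunc_logP//; exact: n0.
Qed.

(** By Borel-Cantelli, no block beyond a random level is bad, and there the bound holds without
    constant. Indices with a zero entry are trivial; the others below that level are finite in
    number and are absorbed by [C]. *)
Lemma lattice_strong_law (eta : R) : 0 < eta ->
  {ae P, forall w, exists C : R, forall n : I,
    `|S n w - mu * box_volume R n| <= eta * box_volume R n `^ beta^-1 + C}.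
Proof.
move=> eta0; have [C C0 [J0 _ hC]] := block_event_le eta0.
pose K j := [set k : {ffun 'I_d -> 'I_j.+1} | (\sum_i k i)%N == j]%SET.
pose B j := if (J0 <= j)%N then \big[setU/set0]_(k in K j) block_event eta k else set0.
have mB j : measurable (B j).
  rewrite /B; case: ifP => // _.
  by apply: bigsetU_measurable => k _; exact: measurable_block_event.
have PB j : (P (B j) <= C%:E * \int[P]_w (dyadic_cost beta D j (X w))%:E)%E.
  have I0 : (0 <= \int[P]_w (dyadic_cost beta D j (X w))%:E)%E.
    by apply: integral_ge0 => w _; rewrite lee_fin dyadic_cost_ge0.
  rewrite /B; case: ifP => [Jj|_]; last by rewrite measure0 mule_ge0.
  rewrite -big_enum/=.
  apply: le_trans (probability_bigsetU_le _ _ _) _.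
    by move=> k; exact: measurable_block_event.
  rewrite big_enum/=; set M := (C%:E * _)%E.
  have M0 : (0 <= M)%E by rewrite mule_ge0.
  have j1 : 0 < j.+1%:R ^+ D :> R by rewrite exprn_gt0.
  (* Each block has probability at most [M / j.+1%:R ^+ D], and there are at most [j.+1 ^ D]
     blocks. *)
  apply: (@le_trans _ _ (\sum_(k in K j) 1%:E * ((j.+1%:R ^+ D)^-1%:E * M))%E).
    apply: lee_sum => k; rewrite inE => /eqP kj.
    by rewrite mul1e lee_pdivlMl// hC.
  rewrite -ge0_sume_distrl// sumEFin sumr_const muleA -EFinM.
  rewrite -[leRHS]mul1e lee_wpmul2r// lee_fin ler_pdivrMr// mul1r.
  by rewrite -natrX ler_nat card_ffun_sum.
have limB : P (lim_sup_set B) = 0%E.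
  apply: lim_sup_set_cvg0 => //.
  apply: (@le_lt_trans _ _ (\sum_(0 <= j <oo) C%:E * \int[P]_w (dyadic_cost beta D j (X w))%:E)%E).
    by apply: lee_nneseries => // j _; exact: PB.
  rewrite nneseriesZl; last first.
    by move=> j _; apply: integral_ge0 => w _; rewrite lee_fin dyadic_cost_ge0.
  by rewrite lte_mul_pinfty//; exact: dyadic_cost_summable.
exists (lim_sup_set B); split => //.
  apply: bigcap_measurable => // n _.
  exact: bigcup_measurable.
move=> w /= nQ; apply: contrapT => nB; apply: nQ.
have [J hJ] : exists J, forall j, (J <= j)%N -> ~ B j w.
  move: nB => /existsNP[J /not_implyP[_ nJ]]; exists J => j Jj Bj.
  by apply: nJ; exists j.
(* An index with positive entries below level [maxn J J0] has all entries at most [M]; the constant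
   adds up the deviations over this whole finite cube. *)
pose M := (2 ^ maxn J J0)%N.
pose V (f : {ffun 'I_d -> 'I_M.+1}) := [ffun i => f i : nat] : I.
exists (\sum_f `|S (V f) w - mu * box_volume R (V f)|) => n.
set C' := \sum_f _.
have C'0 : 0 <= C' by apply: sumr_ge0.
have [[i ni0]|n0] := pselect (exists i, n i = 0%N).
  rewrite (lattice_sum_eq0 _ ni0) (_ : box_volume R n = 0); last first.
    by rewrite /box_volume (bigD1 i)//= ni0 mul0r.
  by rewrite mulr0 subr0 normr0 addr_ge0// mulr_ge0 ?powR_ge0// ltW.
have {}n0 : posidx n.
  by move=> i; rewrite lt0n; apply/eqP => ni; apply: n0; exists i.
have [Jn|nJ] := leqP (maxn J J0) (\sum_i trunc_log 2 (n i))%N.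
  rewrite ler_wpDr// (@block_event_cover eta w)// => k kS kw.
  apply: (hJ (\sum_i trunc_log 2 (n i))%N); first exact: leq_trans (leq_maxl _ _) Jn.
  rewrite /B (leq_trans (leq_maxr _ _) Jn) -big_enum/= -bigcup_seq.
  by exists k => //=; rewrite mem_enum inE kS.
have nM i : (n i <= M)%N.
  apply: ltnW; apply: leq_trans (@trunc_log_ltn 2 (n i) isT) _; rewrite leq_exp2l//.
  by apply: leq_trans nJ; rewrite ltnS (bigD1 i)//= leq_addr.
pose f : {ffun 'I_d -> 'I_M.+1} := [ffun i => inord (n i)].
have nV : n = V f by apply/ffunP => i; rewrite !ffunE inordK// ltnS.
rewrite ler_wpDl ?mulr_ge0 ?powR_ge0 ?(ltW eta0)// /C' (bigD1 f)//= -nV.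
by rewrite lerDl sumr_ge0.
Qed.

End StrongLaw.

(** * Interpolation and renewal sets *)

Section Interpolation.
Context (R : realType).

(** Convexity of [expR] between [ln y] and [0], with weights [p] and [1 - p]. The case [y = 0] is
    apart, since [expR (ln y) = y] needs [0 < y]. *)
Lemma powR_le_tangent (y p : R) : 0 <= y -> 0 < p <= 1 -> y `^ p <= 1 + p * (y - 1).
Proof.
move=> y0 /andP[p0 p1]; move: y0; rewrite le_eqVlt => /predU1P[<-|y0].
  by rewrite powR0 ?gt_eqF//; lra.
have p01 : 0 <= p <= 1 by rewrite p1 ltW.
have := @convex_expR R (Itv01 (ltW p0) p1) (ln y) 0.
rewrite !convRE /= expR0 lnK ?posrE// mulr0 addr0 mulr1.
by rewrite /powR gt_eqF// => /le_trans; apply; rewrite /unstable.onem; lra.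
Qed.

(** Jensen's inequality for a concave power, by the tangent at the mean [A]. If [A = 0], every term
    on the left vanishes. *)
Lemma weighted_powR_le (I : finType) (w a : I -> R) (p : R) :
  (forall i, 0 <= w i) -> \sum_i w i = 1 -> (forall i, 0 <= a i) -> 0 < p <= 1 ->
  \sum_i w i * a i `^ p <= (\sum_i w i * a i) `^ p.
Proof.
move=> w0 w1 a0 p01; have /andP[p0 p1] := p01; set A := \sum_i w i * a i.
have A0 : 0 <= A by apply: sumr_ge0 => i _; rewrite mulr_ge0.
move: A0; rewrite le_eqVlt => /predU1P[A0|A0].
  rewrite big1 ?powR_ge0// => i _; have /eqP := esym A0.
  rewrite psumr_eq0 => [/allP /(_ i)|j _]; last by rewrite mulr_ge0.
  rewrite mem_index_enum mulf_eq0 => /(_ isT) /orP[/eqP->|/eqP->]; first by rewrite mul0r.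
  by rewrite powR0 ?mulr0// gt_eqF.
apply: (@le_trans _ _ (\sum_i A `^ p * (w i * (1 - p) + p / A * (w i * a i)))).
  apply: ler_sum => i _; rewrite (_ : a i = A * (a i / A)); last by field; rewrite gt_eqF.
  rewrite powRM ?divr_ge0 ?(ltW A0)//.
  have := powR_le_tangent (divr_ge0 (a0 i) (ltW A0)) p01.
  move=> /(ler_wpM2l (w0 i)) /(ler_wpM2l (powR_ge0 A p)).
  rewrite mulrCA => /le_trans; apply.
  rewrite le_eqVlt; apply/orP; left; apply/eqP; field.
  by rewrite gt_eqF.
rewrite -mulr_sumr big_split/= -mulr_suml w1 -mulr_sumr -/A.
by rewrite -mulrA mulVf ?gt_eqF// mul1r mulr1 subrK mulr1.
Qed.

Context (d : nat).
Local Notation I := {ffun 'I_d -> nat}.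
Implicit Types (s : I -> R) (x : 'rV[R]_d).

Local Notation floor_index x := ([ffun i => Num.truncn (x 0 i)] : I).

Definition cube_weight (n : I) x (e : {ffun 'I_d -> bool}) : R :=
  \prod_i `|x 0 i - (cube_vertex n e i)%:R|.

(** The weights factor over coordinates, so the sum over vertices becomes a product of linear
    interpolations. Constant [c] gives total weight 1; vertex coordinates for [c] give
    [volume x]. *)
Lemma sum_cube_weight x (c : 'I_d -> bool -> R) : orthant x ->
  \sum_e cube_weight (floor_index x) x e * \prod_i c i (opposite e i) =
  \prod_i ((1 - (x 0 i - (Num.truncn (x 0 i))%:R)) * c i false +
           (x 0 i - (Num.truncn (x 0 i))%:R) * c i true).
Proof.
move=> x0.
pose F i (b : bool) := `|x 0 i - (Num.truncn (x 0%R i) + b)%N%:R| * c i (~~ b).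
transitivity (\prod_i \sum_b F i b).
  rewrite bigA_distr_bigA; apply: eq_bigr => e _.
  rewrite /cube_weight -big_split/=; apply: eq_bigr => i _.
  by rewrite /F /opposite /cube_vertex !ffunE.
apply: eq_bigr => i _; rewrite big_bool /F/= addn0 addn1.
have /andP[lo hi] := truncn_itv (x0 i).
rewrite ler0_norm ?subr_le0 ?(ltW hi)// ger0_norm ?subr_ge0//.
by rewrite -natr1; ring.
Qed.

Lemma multilinear_ext_dev s x (mu eta C p : R) : 0 < p <= 1 -> 0 <= eta ->
  (forall n, `|s n - mu * box_volume R n| <= eta * box_volume R n `^ p + C) ->
  orthant x ->
  `|multilinear_ext s x - mu * volume x| <= eta * volume x `^ p + C.
Proof.
move=> p01 eta0 sC x0; set n := floor_index x.
pose k e := cube_vertex n (opposite e).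
have w0 e : 0 <= cube_weight n x e by exact: prodr_ge0.
have w1 : \sum_e cube_weight n x e = 1.
  have := sum_cube_weight (fun _ _ => 1) x0.
  under [X in X = _ -> _]eq_bigr do rewrite big1 ?mulr1//.
  by move=> ->; rewrite big1// => i _; ring.
have wV : \sum_e cube_weight n x e * box_volume R (k e) = volume x.
  have := sum_cube_weight (fun i b => (Num.truncn (x 0%R i) + b)%N%:R) x0.
  rewrite /volume (eq_bigr (fun i => x 0 i)) => [<-|i _]; last first.
    by rewrite addn0 addn1 -natr1; ring.
  apply: eq_bigr => e _; congr (_ * _); apply: eq_bigr => i _.
  by rewrite /k /cube_vertex !ffunE.
rewrite -{1}wV mulr_sumr /multilinear_ext /cube_interp -/n.
rewrite -sumrB (eq_bigr (fun e => cube_weight n x e *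
  (s (k e) - mu * box_volume R (k e)))) => [|e _]; last first.
  by rewrite mulrBr mulrCA.
apply: (le_trans (ler_norm_sum _ _ _)).
apply: (@le_trans _ _ (\sum_e (eta * (cube_weight n x e * box_volume R (k e) `^ p) + cube_weight n x e * C))).
  apply: ler_sum => e _; rewrite normrM (ger0_norm (w0 e)) mulrCA -mulrDr.
  by rewrite ler_wpM2l.
rewrite big_split/= -mulr_suml w1 mul1r -mulr_sumr lerD2r ler_wpM2l// -wV.
by apply: weighted_powR_le => // e; exact: box_volume_ge0.
Qed.

End Interpolation.

(** * From the deviation bound to renewal sets *)

Section Inclusions.
Context (R : realType) (d : nat).
Implicit Types (x : 'rV[R]_d).

Lemma volumeZ (c : R) x : volume (c *: x) = c ^+ d * volume x.
Proof.
rewrite /volume; under eq_bigr do rewrite mxE.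
by rewrite big_split/= prodr_const card_ord.
Qed.

(** Undoing the scaling multiplies volumes by [t], so the margin becomes eps t^p. Of [mu] times this
    margin, one half absorbs the error in [eta] and the other half absorbs [C]. *)
Lemma renewal_inclusions (a : {ffun 'I_d -> nat} -> R) (mu eps eta C p : R) :
  (0 < d)%N -> 0 < mu -> 0 < eps -> 0 < p <= 1 -> 0 <= eta ->
  eta * (mu^-1 + eps) `^ p <= mu * eps / 2 ->
  (forall x, orthant x ->
    `|multilinear_ext (lattice_sum a) x - mu * volume x| <= eta * volume x `^ p + C) ->
  \forall t \near +oo,
    Hset mu (eps * t `^ (-1 + p))
      `<=` scale_set (t `^ (- d%:R^-1)) (renewal_set a t) /\
    scale_set (t `^ (- d%:R^-1)) (renewal_set a t)
      `<=` Hset mu (- (eps * t `^ (-1 + p))).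
Proof.
move=> d0 mu0 eps0 /andP[p0 p1] eta0 eta_small dev.
(* [G] is the value of t^p from which [|C|] is at most mu eps t^p / 2. *)
pose G := 2 * `|C| / (mu * eps).
have me0 : 0 < mu * eps by rewrite mulr_gt0.
have G0 : 0 <= G by rewrite divr_ge0 ?mulr_ge0// ltW.
have q0 : 0 < mu^-1 + eps by rewrite addr_gt0 ?invr_gt0.
near=> t.
have t1 : 1 <= t by near: t; exact: nbhs_pinfty_ge.
have t0 : 0 < t by exact: lt_le_trans t1.
have Ct : C <= mu * eps / 2 * t `^ p.
  have : G `^ p^-1 <= t by near: t; apply: nbhs_pinfty_ge; exact: num_real.
  move=> /(ge0_ler_powR (ltW p0)); rewrite !nnegrE powR_ge0 ltW// => /(_ isT isT).
  rewrite -powRrM mulVf ?gt_eqF// powRr1// /G ler_pdivrMr// => h.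
  by have := ler_norm C; move: h; lra.
have tp : t `^ p <= t by rewrite -[leRHS]powRr1 ?(ltW t0)// ler_powR.
have tp0 : 0 < t `^ p by rewrite powR_gt0.
have small u : 0 <= u -> u <= (mu^-1 + eps) * t -> eta * u `^ p <= mu * eps / 2 * t `^ p.
  move=> u0 ut; apply: (@le_trans _ _ (eta * ((mu^-1 + eps) * t) `^ p)).
    rewrite ler_wpM2l//; apply: ge0_ler_powR => //; first exact: ltW.
    by rewrite nnegrE (le_trans u0).
  by rewrite powRM ?(ltW q0) ?(ltW t0)// mulrA ler_wpM2r// ltW.
have tpE : t * t `^ (-1 + p) = t `^ p.
  rewrite -{1}[t]powRr1 ?(ltW t0)// -powRD; last by rewrite (gt_eqF t0) implybT.
  by congr (_ `^ _); ring.
set c := t `^ (- d%:R^-1).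
have c0 : 0 < c by rewrite powR_gt0.
have cd : c ^+ d = t^-1.
  rewrite -powR_mulrn ?powR_ge0// -powRrM mulNr mulVf ?pnatr_eq0 -?lt0n//.
  by rewrite powR_inv1// ltW.
have tmu : 0 < t / mu by rewrite divr_gt0.
split=> [y [y0 yH]|_ [x [x0 xM]] <-].
  have cx0 : orthant (c^-1 *: y)
    by move=> i; rewrite mxE; apply: mulr_ge0; [rewrite invr_ge0 ltW|exact: y0].
  exists (c^-1 *: y); last by rewrite scalerA divff ?gt_eqF// scale1r.
  split => //; have := dev _ cx0.
  rewrite volumeZ exprVn cd invrK; set u := t * volume y.
  set M := multilinear_ext _ _ => /ler_normlP[+ _] => dM.
  (* [u0] is the least volume allowed for the unscaled point. The estimate is made at [u0] and then
     carried to all larger [u], whose error term may exceed any multiple of t^p. *)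
  pose u0 := t / mu + eps * t `^ p.
  have u00 : 0 < u0 by rewrite addr_gt0// mulr_gt0.
  have u0u : u0 <= u.
    have := ler_wpM2l (ltW t0) yH; rewrite mulrDr mulrCA tpE.
    by rewrite /u0 /u.
  have su : eta * u0 `^ p <= mu * eps / 2 * t `^ p.
    apply: small; first exact: ltW.
    by rewrite mulrDl mulrC lerD2l ler_wpM2l// ltW.
  have up : u `^ p <= u0 `^ p * (u / u0).
    have uE : u = u0 * (u / u0) by field; rewrite gt_eqF.
    have r1 : 1 <= u / u0 by rewrite ler_pdivlMr// mul1r.
    rewrite {1}uE powRM ?(ltW u00) ?(le_trans ler01 r1)//.
    rewrite ler_wpM2l ?powR_ge0// -[leRHS]powRr1 ?(le_trans ler01 r1)//.
    exact: ler_powR.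
  have muu0 : mu * u0 = t + mu * eps * t `^ p by rewrite /u0; field; rewrite gt_eqF.
  have base : t + mu * eps / 2 * t `^ p <= mu * u0 - eta * u0 `^ p by rewrite muu0; lra.
  have base0 : 0 <= mu * u0 - eta * u0 `^ p.
    by apply: le_trans base; rewrite addr_ge0 ?mulr_ge0 ?ltW// divr_ge0 ?ltW.
  (* As u^p / u does not increase, mu u - eta u^p grows at least proportionally to [u] from its
     nonnegative value at [u0]. *)
  have key : mu * u0 - eta * u0 `^ p <= mu * u - eta * u `^ p.
    have r1 : 1 <= u / u0 by rewrite ler_pdivlMr// mul1r.
    apply: (@le_trans _ _ ((mu * u0 - eta * u0 `^ p) * (u / u0))).
      by rewrite ler_peMr.
    have := ler_wpM2l eta0 up.
    have -> : (mu * u0 - eta * u0 `^ p) * (u / u0) = mu * u - eta * (u0 `^ p * (u / u0)).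
      by field; rewrite gt_eqF.
    lra.
  by move: dM base key Ct; lra.
split; first by move=> i; rewrite mxE; apply: mulr_ge0; [exact: ltW|exact: x0].
have := dev _ x0; rewrite volumeZ cd; set u := volume x.
have u_ge0 : 0 <= u by apply: prodr_ge0 => i _; exact: x0.
move=> /ler_normlP[_ dM].
(* By contradiction: a volume below t / mu - eps t^p would keep the interpolated sum strictly below
   [t]. *)
rewrite leNgt; apply/negP; rewrite mulrC ltr_pdivrMr// mulrDl mulNr -mulrA [t `^ _ * t]mulrC tpE => ut.
have umu : mu * u < t - mu * (eps * t `^ p).
  have := ut; rewrite -(ltr_pM2l mu0) mulrDr mulrN [mu * (_ * t)]mulrA divff ?gt_eqF//.
  by rewrite mul1r.
have su : eta * u `^ p <= mu * eps / 2 * t `^ p.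
  apply: small => //; apply: (le_trans (ltW ut)).
  rewrite mulrDl lerD2l (@le_trans _ _ 0)// ?oppr_le0 ?mulr_ge0 ?ltW//.
by move: xM dM umu su Ct; lra.
Unshelve. all: by end_near. Qed.

End Inclusions.

Theorem corollary2p3 (R : realType) (d : nat) (d_ge2 : (2 <= d)%N)
    (disp : measure_display) (T : measurableType disp) (P : probability T R)
    (X : {RV P >-> R}) (xi : {ffun 'I_d -> nat} -> {RV P >-> R})
    (xi_copies : independent_copies (@posidx d) xi X)
    (X_integrable : P.-integrable [set: T] (EFin \o X))
    (mu : R) (mu_mean : 'E_P[X]%E = mu%:E) (mu_gt0 : 0 < mu)
    (beta : R) (beta_range : 1 <= beta < 2)
    (X_moment :
      ('E_P[fun w => (`|X w| `^ beta * logc `|X w| ^+ d.-1)%R] < +oo)%E)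
    (eps : R) (eps_gt0 : 0 < eps) :
  {ae P, forall w, \forall t \near +oo,
    Hset mu (eps * t `^ (-1 + beta^-1))
      `<=` scale_set (t `^ (- d%:R^-1)) (renewal_set (fun m => xi m w) t) /\
    scale_set (t `^ (- d%:R^-1)) (renewal_set (fun m => xi m w) t)
      `<=` Hset mu (- (eps * t `^ (-1 + beta^-1)))}.
Proof.
case: d d_ge2 xi xi_copies X_moment => // D _ xi xi_copies X_moment.
have /andP[b1 b2] := beta_range.
have b0 : 0 < beta by lra.
have p01 : 0 < beta^-1 <= 1 by rewrite invr_gt0 b0 invf_le1.
have q0 : 0 < (mu^-1 + eps) `^ beta^-1 by rewrite powR_gt0// addr_gt0 ?invr_gt0.
(* This [eta] turns the smallness condition of [renewal_inclusions] into an equality. *)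
pose eta := mu * eps / 2 / (mu^-1 + eps) `^ beta^-1.
have eta0 : 0 < eta by rewrite !divr_gt0// mulr_gt0.
have := lattice_strong_law xi_copies X_integrable mu_mean beta_range X_moment eta0.
apply: filterS => w [C hC].
apply: (@renewal_inclusions _ _ _ _ _ eta C) => //; first exact: ltW.
  by rewrite /eta divfK ?gt_eqF.
move=> x x0; apply: multilinear_ext_dev => //; exact: ltW.
Qed.
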